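(* Let $\mathcal{G}$ be a minimal effective étale groupoid over a space $X$ which is either a Cantor space or a locally compact Cantor space. The following statements on a subgroup $H\in\mathrm{Sub}(\mathsf{F}(\mathcal{G}))$ are equivalent: (i) the subgroup $H$ is confined; (ii) the subgroup $H$ is confined by $\mathsf{A}(\mathcal{G})$; (iii) there exists a unique finite subset $Q\subset X$ (possibly empty) such that $$\mathrm{St}^0_{\mathsf{A}(\mathcal{G})}(Q)\le H\le\mathrm{St}_{\mathsf{F}(\mathcal{G})}(Q).$$ Moreover, if $H$ satisfies one of these equivalent conditions and $P\subset\mathsf{F}(\mathcal{G})\setminus\{1\}$ is a confining set for $H$, then the set $Q$ in (iii) satisfies $|Q|\le|P|-1$.
   Context: A Cantor space is a space homeomorphic to the Cantor set; a locally compact (non-compact) Cantor space is a space homeomorphic to an open, non-closed subset of the Cantor set. An étale groupoid over a Hausdorff space $X$ is a topological groupoid $\mathcal{G}$ (not necessarily Hausdorff) with unit space $X\subset\mathcal{G}$ whose source and range maps $\mathsf{s},\mathsf{r}\colon\mathcal{G}\to X$ are open local homeomorphisms. The orbit of $x$ is $\mathsf{r}(\mathsf{s}^{-1}(x))$; $\mathcal{G}$ is minimal if every orbit is dense. A bisection is an open $T\subset\mathcal{G}$ such that $\mathsf{s}|_T,\mathsf{r}|_T$ are homeomorphisms onto their images; it induces the homeomorphism $\tau(T)=\mathsf{r}|_T\circ(\mathsf{s}|_T)^{-1}\colon\mathsf{s}(T)\to\mathsf{r}(T)$. $\mathcal{G}$ is effective if every bisection is determined by its homeomorphism $\tau(T)$.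 The full group $\mathsf{F}(\mathcal{G})$ is the group of bisections $g$ with $\mathsf{s}(g)=\mathsf{r}(g)=X$ (identified with the homeomorphisms $\tau(g)$ of $X$). $\mathsf{A}(\mathcal{G})\le\mathsf{F}(\mathcal{G})$ is the subgroup generated by all 3-cycles, i.e. elements $g\in\mathsf{F}(\mathcal{G})$ of order 3 for which there are disjoint compact open sets $U_1,U_2,U_3\subset X$ with $g(U_1)=U_2$, $g(U_2)=U_3$, $g(U_3)=U_1$ and $g$ the identity outside $U_1\cup U_2\cup U_3$. For a group $G$, $\mathrm{Sub}(G)$ is the set of subgroups of $G$ with the Chabauty topology (induced from the product topology on $\{0,1\}^G$). For $A\le G$, a subgroup $H\le G$ is confined by $A$ if the closure of $\{aHa^{-1}\colon a\in A\}$ in $\mathrm{Sub}(G)$ does not contain the trivial subgroup $\{1\}$; $H$ is confined if it is confined by $G$. A confining set for a confined subgroup $H\le G$ is a finite set $P\subset G\setminus\{1\}$ such that $P\cap gHg^{-1}\ne\varnothing$ for every $g\in G$. For a group $G$ of homeomorphisms of $X$ and $Q\subset X$, $\mathrm{St}_G(Q)$ is the set-wise stabiliser of $Q$ in $G$ and $\mathrm{St}^0_G(Q)$ is the subgroup of elements that fix point-wise a neighbourhood of $Q$ (so $\mathrm{St}^0_G(\varnothing)=\mathrm{St}_G(\varnothing)=G$). *)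

(* Defs.v *)
From HB Require Import structures.
From mathcomp Require Import all_boot all_order all_algebra finmap.
From mathcomp Require Import all_classical topology cantor.

Set Implicit Arguments.
Unset Strict Implicit.
Unset Printing Implicit Defensive.

Local Open Scope classical_set_scope.

Definition homeomorphic (X Y : topologicalType) : Prop :=
  exists (f : X -> Y) (g : Y -> X),
    [/\ continuous f, continuous g, cancel f g & cancel g f].

(* [f] restricts to a homeomorphism from [A] onto [f @` A], both sets carrying
   the subspace topology. *)
Definition homeo_onto_image (X Y : topologicalType) (A : set X) (f : X -> Y)
    : Prop :=
  {within A, continuous f} /\
  exists g : Y -> X,
    {within f @` A, continuous g} /\ (forall x, A x -> g (f x) = x).

Definition open_map (X Y : topologicalType) (f : X -> Y) : Prop :=
  forall A, open A -> open (f @` A).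

Definition local_homeo (X Y : topologicalType) (f : X -> Y) : Prop :=
  forall x, exists A : set X,
    [/\ open A, A x, open (f @` A) & homeo_onto_image A f].

Definition is_cantor (X : topologicalType) : Prop :=
  homeomorphic X cantor_space.

Definition is_lc_cantor (X : topologicalType) : Prop :=
  exists U : set cantor_space,
    [/\ open U, ~ closed U & homeomorphic X (set_type U)].

(* The product [gmul g h] is meaningful only when [src g = rng h]; it is an
   arbitrary total function off the set of composable pairs. *)
Record etale_groupoid (X : topologicalType) := EtaleGroupoid {
  arrow :> topologicalType;
  src : arrow -> X;
  rng : arrow -> X;
  gunit : X -> arrow;
  gmul : arrow -> arrow -> arrow;
  ginv : arrow -> arrow;
  src_unit : forall x, src (gunit x) = x;
  rng_unit : forall x, rng (gunit x) = x;
  src_mul : forall g h, src g = rng h -> src (gmul g h) = src h;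
  rng_mul : forall g h, src g = rng h -> rng (gmul g h) = rng g;
  gmulA : forall g h k, src g = rng h -> src h = rng k ->
    gmul g (gmul h k) = gmul (gmul g h) k;
  gmul1 : forall g, gmul g (gunit (src g)) = g;
  gmul1l : forall g, gmul (gunit (rng g)) g = g;
  src_inv : forall g, src (ginv g) = rng g;
  rng_inv : forall g, rng (ginv g) = src g;
  gmulV : forall g, gmul g (ginv g) = gunit (rng g);
  gmulVl : forall g, gmul (ginv g) g = gunit (src g);
  (* Continuity of [gunit] and of its left inverse [src] makes [X] a
     topological subspace of [arrow]. *)
  gunit_continuous : continuous gunit;
  ginv_continuous : continuous ginv;
  gmul_continuous :
    {within [set p : arrow * arrow | src p.1 = rng p.2],
      continuous (fun p : arrow * arrow => gmul p.1 p.2)};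
  base_hausdorff : hausdorff_space X;
  src_open : open_map src;
  rng_open : open_map rng;
  src_local_homeo : local_homeo src;
  rng_local_homeo : local_homeo rng
}.

Arguments src {X} _ _ : rename.
Arguments rng {X} _ _ : rename.
Arguments gunit {X} _ _ : rename.
Arguments gmul {X G} _ _ : rename.
Arguments ginv {X G} _ : rename.

Section Groupoid.
Variables (X : topologicalType) (G : etale_groupoid X).

Definition orbit (x : X) : set X := rng G @` (src G @^-1` [set x]).

Definition minimal : Prop := forall x, dense (orbit x).

Definition bisection (T : set G) : Prop :=
  [/\ open T, homeo_onto_image T (src G) & homeo_onto_image T (rng G)].

(* [tau T] is the partial homeomorphism from [src G @` T] to [rng G @` T];
   outside [src G @` T] its value is the irrelevant default [x]. *)
Definition tau (T : set G) : X -> X :=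
  fun x => rng G ('pinv_(gunit G) T (src G) x).

Definition effective : Prop :=
  forall T1 T2 : set G, bisection T1 -> bisection T2 ->
    src G @` T1 = src G @` T2 ->
    (forall x, (src G @` T1) x -> tau T1 x = tau T2 x) ->
    T1 = T2.

Definition full_bisection (T : set G) : Prop :=
  [/\ bisection T, src G @` T = setT & rng G @` T = setT].

Definition bmul (T1 T2 : set G) : set G :=
  [set k | exists g h, [/\ T1 g, T2 h, src G g = rng G h & k = gmul g h]].

Definition binv (T : set G) : set G := ginv @` T.

Lemma local_homeo_continuous (Y Z : topologicalType) (f : Y -> Z) :
  local_homeo f -> continuous f.
Proof.
move=> lf x; have [A [oA Ax _ [/subspace_continuousP cf _]]] := lf x.
have := cf x Ax; rewrite /within /= => h B /h /= nB.
have nA : nbhs x A by apply: open_nbhs_nbhs.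
by apply: filterS (filterI nA nB) => y [Ay]; exact.
Qed.

Lemma src_continuous : continuous (src G).
Proof. by apply: local_homeo_continuous; exact: src_local_homeo. Qed.

Lemma rng_continuous : continuous (rng G).
Proof. by apply: local_homeo_continuous; exact: rng_local_homeo. Qed.

Lemma gmul_comp_continuous (Y : topologicalType) (a b : Y -> G) :
  continuous a -> continuous b -> (forall y, src G (a y) = rng G (b y)) ->
  continuous (fun y => gmul (a y) (b y)).
Proof.
move=> ca cb ab y.
have /subspace_continuousP cm := @gmul_continuous X G.
have /= h := cm (a y, b y) (ab y).
move=> B /h; rewrite /within /= => nB.
have {}nB : nbhs y (fun z => src G (a z) = rng G (b z) -> B (gmul (a z) (b z))).
  exact: (@cvg_pair _ _ _ _ _ _ _ _ _ a b (ca y) (cb y) _ nB).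
change (nbhs y (fun z => B (gmul (a z) (b z)))).
by apply: filterS nB => z; apply; exact: ab.
Qed.

Lemma ginvK (g : G) : ginv (ginv g) = g.
Proof.
have e1 : src G (ginv (ginv g)) = rng G (ginv g) by rewrite src_inv.
have e2 : src G (ginv g) = rng G g by rewrite src_inv.
rewrite -[LHS]gmul1 src_inv rng_inv -gmulVl gmulA //.
by rewrite gmulVl src_inv gmul1l.
Qed.

Lemma full_bisectionP (T : set G) :
  full_bisection T <-> open T /\ exists a b : X -> G,
    [/\ continuous a, forall x, T (a x) /\ src G (a x) = x &
        forall g, T g -> a (src G g) = g] /\
    [/\ continuous b, forall x, T (b x) /\ rng G (b x) = x &
        forall g, T g -> b (rng G g) = g].
Proof.
split=> [[[oT [cs [a [ca aK]]] [cr [b [cb bK]]]] sT rT]|].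
  split=> //; exists a, b; split; split.
  - by apply/continuous_subspace_setT; rewrite -sT.
  - move=> x; have : (src G @` T) x by rewrite sT.
    by move=> [g Tg <-]; rewrite aK.
  - exact: aK.
  - by apply/continuous_subspace_setT; rewrite -rT.
  - move=> x; have : (rng G @` T) x by rewrite rT.
    by move=> [g Tg <-]; rewrite bK.
  - exact: bK.
move=> [oT [a [b [[ca Ta aK] [cb Tb bK]]]]].
have sT : src G @` T = setT.
  by rewrite -subTset => x _; exists (a x); case: (Ta x).
have rT : rng G @` T = setT.
  by rewrite -subTset => x _; exists (b x); case: (Tb x).
split=> //; split=> //; split.
- by apply: continuous_subspaceT; exact: src_continuous.
- by exists a; split=> //; apply: continuous_subspaceT.
- by apply: continuous_subspaceT; exact: rng_continuous.
- by exists b; split=> //; apply: continuous_subspaceT.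
Qed.

Lemma full_bisection1 : full_bisection (range (gunit G)).
Proof.
apply/full_bisectionP; split; last first.
  exists (gunit G), (gunit G); split; split.
  - exact: gunit_continuous.
  - by move=> x; split; [exists x|exact: src_unit].
  - by move=> _ [x _ <-]; rewrite src_unit.
  - exact: gunit_continuous.
  - by move=> x; split; [exists x|exact: rng_unit].
  - by move=> _ [x _ <-]; rewrite rng_unit.
rewrite openE => _ [x _ <-]; rewrite /interior /=.
have [A [oA Ax _ [_ [f [_ fK]]]]] := @src_local_homeo X G (gunit G x).
have nA : nbhs (gunit G x) A by apply: open_nbhs_nbhs.
have nV : nbhs (gunit G x) (src G @^-1` (gunit G @^-1` A)).
  have := @src_continuous (gunit G x); apply => /=.
  by rewrite src_unit; apply: gunit_continuous.
apply: filterS (filterI nA nV) => g [Ag /= Aug].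
by exists (src G g) => //; rewrite -(fK _ Aug) src_unit fK.
Qed.

Lemma full_bisectionM (T1 T2 : set G) :
  full_bisection T1 -> full_bisection T2 -> full_bisection (bmul T1 T2).
Proof.
move=> /full_bisectionP[oT1 [a1 [b1 [[ca1 Ta1 aK1] [cb1 Tb1 bK1]]]]].
move=> /full_bisectionP[oT2 [a2 [b2 [[ca2 Ta2 aK2] [cb2 Tb2 bK2]]]]].
have sa1 x : src G (a1 x) = x by case: (Ta1 x).
have sa2 x : src G (a2 x) = x by case: (Ta2 x).
have rb1 x : rng G (b1 x) = x by case: (Tb1 x).
have rb2 x : rng G (b2 x) = x by case: (Tb2 x).
have scomp (Y Z W : topologicalType) (f : Y -> Z) (h : Z -> W) :
    continuous f -> continuous h -> continuous (fun y => h (f y)).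
  by move=> cf ch y; apply: continuous_comp; [exact: cf|exact: ch].
apply/full_bisectionP; split.
  have -> : bmul T1 T2 = (fun k : G => gmul (ginv (b1 (rng G k))) k) @^-1` T2.
    apply/seteqP; split=> [_ [g [h [T1g T2h gh ->]]]|k /= T2k].
      rewrite /= rng_mul// bK1// gmulA ?src_inv ?rng_mul//.
      by rewrite gmulVl gh gmul1l.
    have e : src G (ginv (b1 (rng G k))) = rng G k by rewrite src_inv rb1.
    exists (b1 (rng G k)), (gmul (ginv (b1 (rng G k))) k); split=> //.
    - by case: (Tb1 (rng G k)).
    - by rewrite rng_mul// rng_inv.
    - by rewrite gmulA ?rng_inv// gmulV rb1 gmul1l.
  suff /continuousP : continuous (fun k : G => gmul (ginv (b1 (rng G k))) k).
    by apply.
  apply: gmul_comp_continuous.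
  - apply: (scomp _ _ _ (fun k => b1 (rng G k)) ginv).
      exact: (scomp _ _ _ _ _ rng_continuous cb1).
    exact: ginv_continuous.
  - by move=> k; exact: cvg_id.
  - by move=> k; rewrite src_inv rb1.
exists (fun x => gmul (a1 (rng G (a2 x))) (a2 x)).
exists (fun x => gmul (b1 x) (b2 (src G (b1 x)))).
split; split.
- apply: gmul_comp_continuous => //.
  apply: (scomp _ _ _ (fun x => rng G (a2 x)) a1) => //.
  exact: (scomp _ _ _ _ _ ca2 rng_continuous).
- move=> x; split; last by rewrite src_mul ?sa1.
  exists (a1 (rng G (a2 x))), (a2 x); split=> //.
  + by case: (Ta1 (rng G (a2 x))).
  + by case: (Ta2 x).
- by move=> _ [g [h [T1g T2h gh ->]]]; rewrite src_mul// aK2// -gh aK1.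
- apply: gmul_comp_continuous => //.
  apply: (scomp _ _ _ (fun x => src G (b1 x)) b2) => //.
  exact: (scomp _ _ _ _ _ cb1 src_continuous).
- move=> x; split; last by rewrite rng_mul ?rb2.
  exists (b1 x), (b2 (src G (b1 x))); split=> //.
  + by case: (Tb1 x).
  + by case: (Tb2 (src G (b1 x))).
- by move=> _ [g [h [T1g T2h gh ->]]]; rewrite rng_mul// bK1// gh bK2.
Qed.

Lemma full_bisectionV (T : set G) :
  full_bisection T -> full_bisection (binv T).
Proof.
move=> /full_bisectionP[oT [a [b [[ca Ta aK] [cb Tb bK]]]]].
have ci := @ginv_continuous X G.
apply/full_bisectionP; split.
  have -> : binv T = ginv @^-1` T.
    apply/seteqP; split=> [_ [g Tg <-]|g Tg] /=; first by rewrite ginvK.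
    by exists (ginv g) => //; rewrite ginvK.
  by move/continuousP : ci; apply.
exists (fun x => ginv (b x)), (fun x => ginv (a x)); split; split.
- by move=> x; apply: continuous_comp; [exact: cb|exact: ci].
- move=> x; rewrite src_inv; case: (Tb x) => Tbx ->; split=> //.
  by exists (b x).
- by move=> _ [g Tg <-]; rewrite src_inv bK.
- by move=> x; apply: continuous_comp; [exact: ca|exact: ci].
- move=> x; rewrite rng_inv; case: (Ta x) => Tax ->; split=> //.
  by exists (a x).
- by move=> _ [g Tg <-]; rewrite rng_inv aK.
Qed.

Lemma full_bisection_src_inj (T : set G) g h :
  full_bisection T -> T g -> T h -> src G g = src G h -> g = h.
Proof.
move=> /full_bisectionP[_ [a [_ [[_ _ aK] _]]]] Tg Th e.
by rewrite -(aK g)// e aK.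
Qed.

Lemma full_bisection_rng_inj (T : set G) g h :
  full_bisection T -> T g -> T h -> rng G g = rng G h -> g = h.
Proof.
move=> /full_bisectionP[_ [_ [b [_ [_ _ bK]]]]] Tg Th e.
by rewrite -(bK g)// e bK.
Qed.

Lemma tauE (T : set G) g :
  full_bisection T -> T g -> tau T (src G g) = rng G g.
Proof.
move=> fT Tg; rewrite /tau pinvKV ?inE//.
by move=> x y; rewrite !inE => Tx Ty; exact: full_bisection_src_inj fT Tx Ty.
Qed.

End Groupoid.

Record full_group (X : topologicalType) (G : etale_groupoid X) := FullGroup {
  fg_set :> set G;
  fg_full : full_bisection fg_set
}.

Section FullGroup.
Variables (X : topologicalType) (G : etale_groupoid X).
Local Notation F := (full_group G).

Lemma full_group_eq (g h : F) : (g : set G) = (h : set G) -> g = h.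
Proof.
case: g h => [S fS] [T fT] /= e; rewrite e in fS *.
by rewrite (Prop_irrelevance fS fT).
Qed.

Definition fg_one : F := FullGroup (full_bisection1 G).
Definition fg_mul (g h : F) : F :=
  FullGroup (full_bisectionM (fg_full g) (fg_full h)).
Definition fg_inv (g : F) : F := FullGroup (full_bisectionV (fg_full g)).

Lemma fg_mulA : associative fg_mul.
Proof.
move=> S T U; apply/full_group_eq/seteqP; split=> k /=.
  move=> [g [_ [Sg [h [l [Th Ul hl ->]]] e ->]]].
  rewrite rng_mul in e => //.
  exists (gmul g h), l; split=> //; last by rewrite gmulA.
    by exists g, h.
  by rewrite src_mul.
move=> [_ [l [[g [h [Sg Th gh ->]]] Ul e ->]]].
rewrite src_mul in e => //.
exists g, (gmul h l); split=> //; last by rewrite gmulA.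
  by exists h, l.
by rewrite rng_mul.
Qed.

Lemma fg_mul1 : left_id fg_one fg_mul.
Proof.
move=> T; apply/full_group_eq/seteqP; split=> k /=.
  by move=> [_ [h [[x _ <-] Th]]]; rewrite src_unit => -> ->; rewrite gmul1l.
move=> Tk; exists (gunit G (rng G k)), k; split=> //.
- by rewrite src_unit.
- by rewrite gmul1l.
Qed.

Lemma fg_mulr1 : right_id fg_one fg_mul.
Proof.
move=> T; apply/full_group_eq/seteqP; split=> k /=.
  by move=> [h [_ [Th [x _ <-]]]]; rewrite rng_unit => <- ->; rewrite gmul1.
move=> Tk; exists k, (gunit G (src G k)); split=> //.
- by rewrite rng_unit.
- by rewrite gmul1.
Qed.

Lemma fg_mulV : left_inverse fg_one fg_inv fg_mul.
Proof.
move=> T; apply/full_group_eq/seteqP; split=> k /=.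
  move=> [_ [h [[g Tg <-] Th]]]; rewrite src_inv => e ->.
  rewrite (full_bisection_rng_inj (fg_full T) Tg Th e) gmulVl.
  by exists (src G h).
move=> [x _ <-]; have [_ sT _] := fg_full T.
have : (src G @` T) x by rewrite sT.
move=> [g Tg <-]; exists (ginv g), g; split=> //.
- by exists g.
- by rewrite src_inv.
- by rewrite gmulVl.
Qed.

Lemma fg_mulVr : right_inverse fg_one fg_inv fg_mul.
Proof.
move=> T; apply/full_group_eq/seteqP; split=> k /=.
  move=> [g [_ [Tg [h Th <-]]]]; rewrite rng_inv => e ->.
  rewrite (full_bisection_src_inj (fg_full T) Tg Th e) gmulV.
  by exists (rng G h).
move=> [x _ <-]; have [_ _ rT] := fg_full T.
have : (rng G @` T) x by rewrite rT.
move=> [g Tg <-]; exists g, (ginv g); split=> //.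
- by exists g.
- by rewrite rng_inv.
- by rewrite gmulV.
Qed.

HB.instance Definition _ := gen_eqMixin F.
HB.instance Definition _ := gen_choiceMixin F.
HB.instance Definition _ :=
  isGroup.Build F fg_mulA fg_mul1 fg_mulr1 fg_mulV fg_mulVr.

Definition act (g : F) : X -> X := tau g.

Lemma act_mul (g h : F) (x : X) : act (g * h)%g x = act g (act h x).
Proof.
have [_ sh _] := fg_full h; have : (src G @` h) x by rewrite sh.
move=> [b hb <-]; rewrite /act (tauE (fg_full h) hb).
have [_ sg _] := fg_full g; have : (src G @` g) (rng G b) by rewrite sg.
move=> [a ga ab]; rewrite -ab (tauE (fg_full g) ga) -(src_mul ab).
by rewrite (tauE (fg_full (g * h)%g)) ?rng_mul//; exists a, b.
Qed.

End FullGroup.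

Record subgroup (K : groupType) := Subgroup {
  sg_set :> set K;
  sg_closed : group_closed [in sg_set]
}.

Section Subgroup.
Variable K : groupType.
Local Open Scope group_scope.

HB.instance Definition _ := gen_eqMixin (subgroup K).
HB.instance Definition _ := gen_choiceMixin (subgroup K).

Definition indicator (H : subgroup K) : prod_topology (fun _ : K => bool) :=
  fun g => g \in (H : set K).

(* The Chabauty topology. *)
HB.instance Definition _ :=
  Topological.copy (subgroup K) (initial_topology indicator).

Lemma sub1_closed : group_closed [in [set 1 : K]].
Proof.
split=> [|x y]; rewrite ?inE//.
by move=> -> ->; rewrite divg1.
Qed.
Definition sub1 : subgroup K := Subgroup sub1_closed.

Lemma subT_closed : group_closed [in [set: K]].
Proof. by split=> [|x y]; rewrite ?inE. Qed.
Definition subT : subgroup K := Subgroup subT_closed.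

Lemma gen_closed (S : set K) :
  group_closed
    [in [set g | forall H : subgroup K, S `<=` H -> (H : set K) g]].
Proof.
split=> [|x y]; rewrite ?inE /=.
  by move=> H _; have [+ _] := sg_closed H; rewrite inE.
move=> Sx Sy H SH; have [_ /(_ x y)] := sg_closed H.
by rewrite !inE; apply; [exact: Sx|exact: Sy].
Qed.
Definition generated (S : set K) : subgroup K := Subgroup (gen_closed S).

Lemma conj_closed (g : K) (H : subgroup K) :
  group_closed [in [set g * h * g^-1 | h in (H : set K)]].
Proof.
have [H1 HB] := sg_closed H; split=> [|x y]; rewrite ?inE /=.
  by exists 1; rewrite ?mulg1 ?mulgV//; rewrite inE in H1.
move=> [h Hh <-] [k Hk <-]; exists (h / k).
  by have := HB h k; rewrite !inE; apply.
by rewrite !invgM invgK !mulgA mulgVK.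
Qed.
Definition conj_subgroup (g : K) (H : subgroup K) : subgroup K :=
  Subgroup (conj_closed g H).

Definition confined_by (A H : subgroup K) : Prop :=
  ~ closure [set conj_subgroup a H | a in (A : set K)] sub1.

Definition confined (H : subgroup K) : Prop := confined_by subT H.

Definition confining_set (P : set K) (H : subgroup K) : Prop :=
  [/\ finite_set P, P `<=` ~` [set 1] &
      forall g : K, P `&` conj_subgroup g H !=set0].

Definition has_order (g : K) (n : nat) : Prop :=
  [/\ (0 < n)%N, g ^+ n = 1 & forall m, (0 < m < n)%N -> g ^+ m <> 1].

End Subgroup.

Section Dynamics.
Variables (X : topologicalType) (G : etale_groupoid X).
Local Notation F := (full_group G).

Definition three_cycle (g : F) : Prop :=
  has_order g 3 /\
  exists U1 U2 U3 : set X,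
    [/\ [/\ compact U1, compact U2 & compact U3],
        [/\ open U1, open U2 & open U3],
        [/\ U1 `&` U2 = set0, U2 `&` U3 = set0 & U1 `&` U3 = set0],
        [/\ act g @` U1 = U2, act g @` U2 = U3 & act g @` U3 = U1] &
        forall x, ~ (U1 `|` U2 `|` U3) x -> act g x = x].

Definition alternating_full_group : subgroup F :=
  generated [set g | three_cycle g].

(* [K] is a group of homeomorphisms of [X] through [act]. *)
Definition setwise_stab (K : subgroup F) (Q : set X) : set F :=
  [set g | (K : set F) g /\ act g @` Q = Q].

Definition nbhs_fixator (K : subgroup F) (Q : set X) : set F :=
  [set g | (K : set F) g /\ set_nbhs Q [set x | act g x = x]].

End Dynamics.

(* Main.v *)
Require Import Defs.
From HB Require Import structures.
From mathcomp Require Import all_boot all_order all_algebra finmap.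
From mathcomp Require Import all_classical topology cantor.

(** Write F for the full group, A for the alternating full group, and call a
    three-cycle, or the identity, a tricycle.  By effectiveness an element of F
    is a homeomorphism of X, and a bijection of X that agrees near every point
    with elements of F lies in F ([glue_acts]).  So three-cycles can be built
    from any compact open V and two elements of F moving V to disjoint places
    ([make_tricycle]), and by minimality the places can be chosen in any open
    set ([mover]).

    Confinement of H by A means that some finite set P of nontrivial elements
    meets all conjugates of H by A ([confined_byP]).  The first step is to find
    a nonempty open M such that H contains all tricycles supported in M
    ([contains_local_tricycles]).  If for one r in P a condition on the
    conjugating element forces r ^ a outside H, impose it and discard r; since
    P is finite and cannot be exhausted, some conjugate s of a member of P is
    such that s ^ (b * c) lies in H for every b, with a correction c supported
    wherever we like ([forcing]).  For b in A supported in M, where s moves M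
    off itself, the quotient of s ^ b0 and s ^ b1 acts on M as b0^-1 b1, and on
    s^-1 M as a conjugate of b0 b1^-1.  With b0, b1 = 1, t and then g, g u the
    actions on s^-1 M have disjoint supports as soon as g moves the support of
    u off that of t; a commutator therefore only sees M, and is [t, u] there,
    while the four corrections were chosen with disjoint supports and disappear
    ([commutator_of_quotients]).  Small three-cycles are such commutators,
    because (1 2 3) is the commutator of (1 2 4) and (1 3 5), and by
    compactness every three-cycle is a product of small ones
    ([tricycle_local]).

    Link two points when they lie in a common open set all of whose tricycles
    are in H.  Linking is transitive, since tricycles supported in two
    overlapping open sets generate those of the union ([all_tricyclesU]), and
    it is preserved by H.  Let O be the open set of points linked to
    themselves.  If its complement were infinite, or if there were two classes
    in O, then elements of A could be chosen that make a conjugate of s break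
    this invariant structure at prescribed points ([escape]), against the
    forcing lemma.  So Q = X minus O is finite and H contains every tricycle
    supported in O ([free_part_spec]).

    It remains that an element of A fixing a neighbourhood of Q is a product of
    three-cycles avoiding Q ([alternating_fixator]).  Removing one point p of
    Q at a time, follow p along a product of three-cycles: modulo tricycles
    avoiding p, a product depends only on its germ at p, which is a
    simple-connectedness statement reflecting that three-cycles moving a point
    the same way differ by a tricycle that misses it
    ([replace_third_vertex], [coset_step], [alt_on_point]).

    Conversely, if H contains the fixator of a neighbourhood of Q, any
    |Q| + 1 three-cycles with disjoint supports form a confining set, because
    one of them misses a Q ([disjoint_tricycles]).  And if a confining set P
    had at most |Q| members, one could assign to each r in P its own point of Q
    and conjugate so that every r sends this point out of Q ([displace]). *)

Set Implicit Arguments.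
Unset Strict Implicit.
Unset Printing Implicit Defensive.
Local Open Scope classical_set_scope.

(** * Cantor spaces and their open subspaces *)

(** Zero-dimensionality and local compactness in one statement; this and the
    absence of isolated points are what is used of a Cantor space, compact or not. *)
Definition compact_open_basis (X : topologicalType) : Prop :=
  forall (x : X) N, nbhs x N ->
    exists K, [/\ open K, compact K, K x & K `<=` N].

Definition no_isolated_point (X : topologicalType) : Prop :=
  forall x : X, ~ open [set x].

Lemma cantor_space_basis : compact_open_basis cantor_space.
Proof.
move=> x N nN.
have /(_ N nN) [K [Kx [oK cK]] KN] := zero_dimensional_cvg (x := x)
  cantor_space_hausdorff cantor_zero_dimensional cantor_space_compact.
exists K; split=> //.
by apply: (subclosed_compact cK cantor_space_compact).
Qed.

Lemma cantor_space_no_isolated : no_isolated_point cantor_space.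
Proof.
move=> x ox; have [_ lim] := cantor_perfect.
have : limit_point [set: cantor_space] x by rewrite lim.
move=> /(_ [set x] (open_nbhs_nbhs (conj ox erefl))) [y [yx _ /= e]].
by rewrite e eqxx in yx.
Qed.

(** A compact open subset of Y contained in U stays compact in the subspace U:
    it is the image of itself under the partial inverse of the inclusion. *)
Lemma open_subtype_basis (Y : topologicalType) (U : set Y) :
  open U -> compact_open_basis Y -> compact_open_basis (set_type U).
Proof.
move=> oU bY x N.
rewrite nbhsE => -[_ [[B oB <-] Bx BN]].
have Ux : U (set_val x) by exact: set_valP.
have [K [oK cK Kx KUB]] : exists K, [/\ open K, compact K, K (set_val x) &
    K `<=` U `&` B].
  by apply: bY; apply: open_nbhs_nbhs; split=> //; exact: openI.
exists (set_val @^-1` K); split=> //; first by exists K.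
- have eK : set_val @^-1` K = (fun y => insubd x y) @` K.
    apply/seteqP; split=> [z Kz|_ [y Ky <-]] /=.
      by exists (set_val z) => //; rewrite set_valE valKd.
    rewrite set_valE insubdK//; apply/mem_set; by case: (KUB _ Ky).
  rewrite eK; apply: continuous_compact => //.
  apply/subspace_continuousP => y Ky A; rewrite nbhsE => -[_ [[C oC <-] Cy CA]].
  rewrite /within /=; have nC : nbhs y C.
    apply: open_nbhs_nbhs; split=> //; move: Cy => /=.
    by rewrite set_valE insubdK//; apply/mem_set; case: (KUB _ Ky).
  rewrite nbhs_simpl /=; apply: filterS nC => z Cz Kz; apply: CA => /=.
  by rewrite set_valE insubdK//; apply/mem_set; case: (KUB _ Kz).
- by move=> z /= /KUB [_ Bz]; apply: BN.
Qed.

Lemma open_subtype_no_isolated (Y : topologicalType) (U : set Y) :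
  open U -> no_isolated_point Y -> no_isolated_point (set_type U).
Proof.
move=> oU iY x [B oB Bx]; apply: (iY (set_val x)).
suff <- : B `&` U = [set set_val x] by exact: openI.
apply/seteqP; split=> [z [Bz Uz]|_ ->] /=.
  have : (set_val @^-1` B) (exist _ z (mem_set Uz) : set_type U) by [].
  by rewrite Bx => <-.
split; last exact: set_valP.
by have : [set x] x by []; rewrite -Bx.
Qed.

Lemma homeomorphic_basis (X Y : topologicalType) :
  homeomorphic X Y -> compact_open_basis Y -> compact_open_basis X.
Proof.
move=> [f [g [cf cg fK gK]]] bY x N nN.
have [K [oK cK Kx KN]] : exists K, [/\ open K, compact K, K (f x) &
    K `<=` g @^-1` N].
  by apply: bY; apply: cg; rewrite /= fK.
exists (g @` K); split.
- have -> : g @` K = f @^-1` K.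
    apply/seteqP; split=> [_ [y Ky <-]|z /= Kz] /=; first by rewrite gK.
    by exists (f z).
  by move/continuousP: cf; apply.
- by apply: continuous_compact => //; apply: continuous_subspaceT.
- by exists (f x).
- by move=> _ [y Ky <-]; apply: KN.
Qed.

Lemma homeomorphic_no_isolated (X Y : topologicalType) :
  homeomorphic X Y -> no_isolated_point Y -> no_isolated_point X.
Proof.
move=> [f [g [cf cg fK gK]]] iY x ox; apply: (iY (f x)).
have -> : [set f x] = g @^-1` [set x].
  by apply/seteqP; split=> [_ -> //=|z /= <-]; rewrite ?gK.
by move/continuousP: cg; apply.
Qed.

Lemma cantor_cases (X : topologicalType) : is_cantor X \/ is_lc_cantor X ->
  [/\ compact_open_basis X, no_isolated_point X & exists x : X, True].
Proof.
move=> [hX|[U [oU nU hX]]].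
  split.
  - exact: homeomorphic_basis hX cantor_space_basis.
  - exact: homeomorphic_no_isolated hX cantor_space_no_isolated.
  - by case: hX => f [g _]; exists (g (fun=> true)).
split.
- exact: homeomorphic_basis hX (open_subtype_basis oU cantor_space_basis).
- apply: homeomorphic_no_isolated hX _.
  exact: open_subtype_no_isolated cantor_space_no_isolated.
- have [E|/set0P [y Uy]] := eqVneq U set0.
    by case: nU; rewrite E; exact: closed0.
  by case: hX => f [g _]; exists (g (exist _ y (mem_set Uy))).
Qed.

(** * Subgroups, slices and gluing in the full group *)

Section SubgroupTheory.
Variable K : groupType.
Local Open Scope group_scope.
Implicit Types (H : subgroup K) (g h : K).

Lemma sg1 H : sg_set H 1.
Proof. by have [+ _] := sg_closed H; rewrite inE. Qed.

Lemma sgF H g h : sg_set H g -> sg_set H h -> sg_set H (g / h).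
Proof. by have [_ /(_ g h)] := sg_closed H; rewrite !inE => + ? ?; apply. Qed.

Lemma sgV H g : sg_set H g -> sg_set H g^-1.
Proof. by move=> /(sgF (sg1 H)); rewrite div1g. Qed.

Lemma sgM H g h : sg_set H g -> sg_set H h -> sg_set H (g * h).
Proof. by move=> Hg /sgV /(sgF Hg); rewrite invgK. Qed.

Lemma sgJ H g h : sg_set H g -> sg_set H h -> sg_set H (g ^ h).
Proof. by move=> Hg Hh; apply: sgM (sgV Hh) (sgM Hg Hh). Qed.

Lemma gen_sub (S : set K) H : S `<=` sg_set H -> generated S `<=` sg_set H.
Proof. by move=> SH g; apply. Qed.

Lemma sub_gen (S : set K) : S `<=` generated S.
Proof. by move=> g Sg H; apply. Qed.

Lemma gen_monotone (S T : set K) : S `<=` T -> generated S `<=` generated T.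
Proof. by move=> ST; apply: gen_sub => g /ST; exact: sub_gen. Qed.

Lemma conj_subgroupE g H h : sg_set (conj_subgroup g H) h <-> sg_set H (h ^ g).
Proof.
split=> [[k Hk <-]|Hh]; last first.
  by exists (h ^ g) => //; rewrite conjgE !mulgA mulgV mul1g mulgK.
by rewrite conjgE !mulgA mulVg mul1g mulgVK.
Qed.

End SubgroupTheory.

Section Groupoid.
Variables (X : topologicalType) (G : etale_groupoid X).

(** A bisection presented by injectivity alone: continuity of the inverses is
    automatic, the source and range maps being open. *)
Definition slice (T : set G) : Prop :=
  [/\ open T, {in T &, injective (src G)} & {in T &, injective (rng G)}].

Lemma slice_bisection T : slice T -> bisection T.
Proof.
move=> [oT iS iR].
have homeo (f : G -> X) : continuous f -> open_map f -> {in T &, injective f} ->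
    homeo_onto_image T f.
  move=> cf of_ fi; split; first exact: continuous_subspaceT.
  exists ('pinv_(gunit G) T f); split=> [|g Tg]; last first.
    by rewrite pinvKV// inE.
  apply/subspace_continuousP => _ [g Tg <-] A.
  rewrite nbhs_simpl /= /from_subspace pinvKV ?inE// nbhsE => -[B [oB Bg] BA].
  rewrite /within /=.
  have : nbhs (f g) (f @` (T `&` B)).
    by apply: open_nbhs_nbhs; split; [apply: of_; exact: openI|exists g].
  rewrite nbhs_simpl; apply: filterS => _ [h [Th Bh] <-] _ /=.
  by rewrite pinvKV ?inE//; apply: BA.
by split=> //; apply: homeo => //;
  [exact: src_continuous|exact: src_open|exact: rng_continuous|exact: rng_open].
Qed.

Lemma tau_slice T g : slice T -> T g -> tau T (src G g) = rng G g.
Proof. by move=> [_ iS _] Tg; rewrite /tau pinvKV ?inE. Qed.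

Lemma slice_setI T (B : set G) : open B -> slice T -> slice (T `&` B).
Proof.
move=> oB [oT iS iR]; split; first exact: openI.
- by move=> x y /[!inE] -[Tx _] [Ty _]; apply: iS; rewrite inE.
- by move=> x y /[!inE] -[Tx _] [Ty _]; apply: iR; rewrite inE.
Qed.

Lemma slice_at (g : G) : exists2 T, slice T & T g.
Proof.
have [A [oA Ag _ [_ [a [_ aK]]]]] := @src_local_homeo X G g.
have [B [oB Bg _ [_ [b [_ bK]]]]] := @rng_local_homeo X G g.
exists (A `&` B) => //; split; first exact: openI.
- move=> x y; rewrite !inE => -[Ax _] [Ay _] e.
  by rewrite -(aK x)// e aK.
- move=> x y; rewrite !inE => -[_ Bx] [_ By] e.
  by rewrite -(bK x)// e bK.
Qed.

Lemma slice_inv T : slice T -> slice (binv T).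
Proof.
move=> [oT iS iR]; split.
- have -> : binv T = ginv @^-1` T.
    apply/seteqP; split=> [_ [g Tg <-]|g Tg] /=; first by rewrite ginvK.
    by exists (ginv g) => //; rewrite ginvK.
  by have /continuousP := @ginv_continuous X G; apply.
- move=> _ _ /[!inE] -[g Tg <-] [h Th <-]; rewrite !src_inv => e.
  by congr ginv; apply: iR; rewrite ?inE.
- move=> _ _ /[!inE] -[g Tg <-] [h Th <-]; rewrite !rng_inv => e.
  by congr ginv; apply: iS; rewrite ?inE.
Qed.

Lemma full_slice T : full_bisection T -> slice T.
Proof.
move=> fT; have [[oT _ _] _ _] := fT; split=> //.
- by move=> x y; rewrite !inE => Tx Ty; exact: full_bisection_src_inj Tx Ty.
- by move=> x y; rewrite !inE => Tx Ty; exact: full_bisection_rng_inj Tx Ty.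
Qed.

(** The partial homeomorphism induced by the slice T is a restriction of f. *)
Definition covers (T : set G) (f : X -> X) : Prop :=
  slice T /\ forall g, T g -> rng G g = f (src G g).

Hypothesis effG : effective G.

(** Effectiveness determines germs: cut both slices down to the common part of
    their sources, where they induce the same map and hence coincide. *)
Lemma covers_unique T1 T2 f g1 g2 : covers T1 f -> covers T2 f ->
  T1 g1 -> T2 g2 -> src G g1 = src G g2 -> g1 = g2.
Proof.
move=> [s1 r1] [s2 r2] Tg1 Tg2 e12.
have oimg T : slice T -> open (src G @^-1` (src G @` T)).
  move=> [oT _ _]; have /continuousP := @src_continuous X G; apply.
  exact: src_open.
have s1' := slice_setI (oimg _ s2) s1; have s2' := slice_setI (oimg _ s1) s2.
have : T1 `&` src G @^-1` (src G @` T2) = T2 `&` src G @^-1` (src G @` T1).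
  apply: effG; [exact: slice_bisection|exact: slice_bisection| |].
  - apply/seteqP; split=> _ [g [Tg [h Th e]] <-]; exists h => //.
      by split=> //; exists g.
    by split=> //; exists g.
  - move=> _ [g [Tg [h Th e]] <-].
    rewrite (tau_slice s1')//; last by split=> //; exists h.
    rewrite -e (tau_slice s2')//; last by split=> //; exists g.
    by rewrite r1// r2// e.
move=> /seteqP[/(_ g1) + _].
case; first by split=> //; exists g2.
move=> Tg1' _; have [_ iS _] := s2.
by apply: iS; rewrite ?inE.
Qed.

Local Notation F := (full_group G).

(** The union of all slices covered by f is a full bisection: arrows over the same
    point coincide by [covers_unique], so it meets each source fibre once. *)
Lemma glue_slices (f f' : X -> X) : cancel f f' -> cancel f' f ->
  (forall x, exists2 T, covers T f & (src G @` T) x) ->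
  exists h : F, forall x, act h x = f x.
Proof.
move=> fK f'K loc.
pose T : set G := [set g | exists2 S, covers S f & S g].
have rT g : T g -> rng G g = f (src G g) by move=> [S [_ +] Sg]; apply.
have sT : src G @` T = setT.
  rewrite -subTset => x _; have [S cS [g Sg <-]] := loc x.
  by exists g => //; exists S.
have sl : slice T.
  split.
  - have -> : T = \bigcup_(S in [set S | covers S f]) S.
      by apply/seteqP; split=> g [S cS Sg]; exists S.
    by apply: bigcup_open => S [[]].
  - move=> g h; rewrite !inE => -[S cS Sg] [S' cS' Sh].
    exact: covers_unique cS cS' Sg Sh.
  - move=> g h; rewrite !inE => Tg Th; rewrite !rT// => /(can_inj fK).
    move: Tg Th => -[S cS Sg] [S' cS' Sh].
    exact: covers_unique cS cS' Sg Sh.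
have fT : full_bisection T.
  split=> //; first exact: slice_bisection.
  rewrite -subTset => x _.
  have : (src G @` T) (f' x) by rewrite sT.
  by move=> [g Tg e]; exists g => //; rewrite rT// e f'K.
exists (FullGroup fT) => x.
have : (src G @` T) x by rewrite sT.
by move=> [g Tg <-]; rewrite /act tauE// rT.
Qed.

Lemma act_covers (g : F) (V : set X) f : open V ->
  (forall x, V x -> f x = act g x) ->
  covers (fg_set g `&` src G @^-1` V) f.
Proof.
move=> oV e; split.
  apply: slice_setI; last exact: full_slice (fg_full g).
  by have /continuousP := @src_continuous X G; apply.
by move=> k [gk Vk]; rewrite e// /act (tauE (fg_full g)).
Qed.

Lemma act_src (g : F) x : (src G @` fg_set g) x.
Proof. by have [_ -> _] := fg_full g. Qed.

Lemma glue_acts (f f' : X -> X) : cancel f f' -> cancel f' f ->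
  (forall x : X, exists g : F, nbhs x [set y | f y = act g y]) ->
  exists h : F, forall x, act h x = f x.
Proof.
move=> fK f'K loc; apply: glue_slices fK f'K _ => x.
have [g nV] := loc x; move: nV; rewrite nbhsE => -[V [oV Vx] Vf].
exists (fg_set g `&` src G @^-1` V); first exact: act_covers.
have [k gk e] := act_src g x.
by exists k => //; split=> //=; rewrite e.
Qed.

Lemma act1 x : act (1%g : F) x = x.
Proof.
have [k gk e] := act_src (1%g : F) x.
rewrite -e /act (tauE (fg_full (1%g : F)))//.
by move: gk => [y _ <-]; rewrite rng_unit src_unit.
Qed.

Lemma actK (g : F) : cancel (act g) (act g^-1%g).
Proof. by move=> x; rewrite -act_mul mulVg act1. Qed.

Lemma actKV (g : F) : cancel (act g^-1%g) (act g).
Proof. by move=> x; rewrite -act_mul mulgV act1. Qed.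

Lemma act_inj (g : F) : injective (act g).
Proof. exact: can_inj (actK g). Qed.

Lemma act_continuous (g : F) : continuous (act g).
Proof.
move=> x; have [k gk e] := act_src g x.
move=> A; rewrite -e nbhsE => -[B [oB Bk] BA].
have [oT _ _] := full_slice (fg_full g).
have : nbhs (src G k) (src G @` (fg_set g `&` rng G @^-1` B)).
  apply: open_nbhs_nbhs; split; last first.
    by exists k => //; split=> //=; rewrite -(tauE (fg_full g) gk).
  apply: src_open; apply: openI => //.
  by have /continuousP := @rng_continuous X G; apply.
rewrite nbhs_simpl /=; apply: filterS => _ [l [gl Bl] <-] /=.
by apply: BA; rewrite /act (tauE (fg_full g)).
Qed.

Lemma act_faithful (g h : F) : (forall x, act g x = act h x) -> g = h.
Proof.
move=> e; apply: full_group_eq.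
have [bg sg _] := fg_full g; have [bh sh _] := fg_full h.
by apply: effG => // [|x _]; [rewrite sg sh|exact: e].
Qed.

End Groupoid.

(** * Moving points along orbits *)

Section Separation.
Variable X : topologicalType.
Hypothesis T2 : hausdorff_space X.

Lemma open_neq (x : X) : open [set y | y <> x].
Proof.
have /closed_openC := @accessible_closed_set1 X (hausdorff_accessible T2) x.
by congr open; apply/seteqP; split.
Qed.

Lemma open_notin (E : seq X) : open [set y | y \notin E].
Proof.
elim: E => [|x E IH].
  have -> : [set y : X | y \notin [::]] = setT by apply/seteqP; split.
  exact: openT.
suff -> : [set y | y \notin x :: E] = [set y | y <> x] `&` [set y | y \notin E].
  by apply: openI => //; exact: open_neq.
apply/seteqP; split=> y /=; rewrite in_cons negb_or.
  by move=> /andP[/eqP].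
by move=> [/eqP -> ->].
Qed.

(** If O were contained in E, removing all but one of its points would isolate
    that point. *)
Lemma avoid_finite (O : set X) (E : seq X) : no_isolated_point X ->
  open O -> O !=set0 -> O `&` [set y | y \notin E] !=set0.
Proof.
move=> iX oO [x Ox]; apply: contrapT => nO.
apply: (iX x); have -> : [set x] = O `&` [set y | y \notin [seq z <- E | z != x]].
  apply/seteqP; split=> [_ -> /=|y [Oy /= yE]].
    by split=> //; rewrite mem_filter eqxx.
  apply: contrapT => yx; apply: nO; exists y; split=> //=.
  by move: yE; rewrite mem_filter; case: eqP.
by apply: openI => //; exact: open_notin.
Qed.

Lemma sep_points (x y : X) : x <> y ->
  exists A B : set X, [/\ open A, open B, A x, B y & A `&` B = set0].
Proof.
move=> /eqP xy; have := T2; rewrite open_hausdorff => /(_ x y xy).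
move=> [[A B] /= [+ +] [oA oB] AB]; rewrite !inE => Ax By.
by exists A, B; split=> //; apply/eqP.
Qed.

Lemma clopen_near (V : set X) x : open V -> closed V ->
  nbhs x [set y | V y <-> V x].
Proof.
move=> oV cV; case: (pselect (V x)) => Vx.
  apply: filterS (open_nbhs_nbhs (conj oV Vx)) => y Vy /=.
  by split.
apply: filterS (open_nbhs_nbhs (conj (closed_openC cV) (Vx : (~` V) x))).
by move=> y /= nVy.
Qed.

End Separation.

Section Swap.
Variables (X : topologicalType) (G : etale_groupoid X).
Local Notation F := (full_group G).
Hypothesis effG : effective G.
Hypothesis bX : compact_open_basis X.
Let T2 : hausdorff_space X := base_hausdorff G.

Lemma tau_cvg (T : set G) k : slice T -> T k -> forall A, nbhs (rng G k) A ->
  nbhs (src G k) (tau T @^-1` A).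
Proof.
move=> sT Tk A; rewrite nbhsE => -[B [oB Bk] BA]; have [oT _ _] := sT.
have : nbhs (src G k) (src G @` (T `&` rng G @^-1` B)).
  apply: open_nbhs_nbhs; split; last by exists k.
  apply: src_open; apply: openI => //.
  by have /continuousP := @rng_continuous X G; apply.
by apply: filterS => _ [l [gl Bl] <-] /=; apply: BA; rewrite tau_slice.
Qed.

(** Exchange a small compact open neighbourhood of the source with its image
    under a slice through the arrow; disjointness of the two makes this an
    involution. *)
Lemma arrow_full_group (k : G) : src G k <> rng G k ->
  exists g : F, act g (src G k) = rng G k.
Proof.
move=> xy; have [A [B [oA oB Ak Bk AB]]] := sep_points T2 xy.
have [T sT Tk] := slice_at k.
have cs := @src_continuous X G; have cr := @rng_continuous X G.
have oT' : open (T `&` (src G @^-1` A `&` rng G @^-1` B)).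
  have [oT _ _] := sT; apply: openI => //.
  by apply: openI; [move/continuousP: cs|move/continuousP: cr]; apply.
have [K [oK cK Kk KT]] : exists K, [/\ open K, compact K, K (src G k) &
    K `<=` src G @` (T `&` (src G @^-1` A `&` rng G @^-1` B))].
  apply: bX; apply: open_nbhs_nbhs; split; first exact: src_open.
  by exists k.
pose T0 := (T `&` rng G @^-1` B) `&` src G @^-1` K.
have sT0 : slice T0.
  apply: slice_setI; first by move/continuousP: cs; apply.
  by apply: slice_setI => //; move/continuousP: cr; apply.
have KE : K = src G @` T0.
  apply/seteqP; split=> [x Kx|_ [g [_ Kg] <-]//].
  by have [g [Tg [_ Bg]] e] := KT x Kx; exists g => //; split=> //=; rewrite e.
pose K' := rng G @` T0.
have K'E : K' = tau T0 @` K.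
  rewrite KE; apply/seteqP; split=> [_ [g Tg <-]|_ [_ [g Tg <-] <-]].
    by exists (src G g); [exists g|rewrite tau_slice].
  by exists g => //; rewrite tau_slice.
have cK' : closed K'.
  apply: compact_closed => //; rewrite K'E; apply: continuous_compact => //.
  apply/subspace_continuousP => x; rewrite {1}KE => -[g Tg <-] C nC.
  rewrite /within /= nbhs_simpl /=.
  have : nbhs (rng G g) C by move: nC; rewrite /from_subspace tau_slice.
  by move=> /(tau_cvg sT0 Tg); apply: filterS => z Cz _.
have KK' x : K x -> ~ K' x.
  move=> /KT [g [_ [Ag _]] e] [h [[_ /= Bh] _] e'].
  have : (A `&` B) x by split; [rewrite -e|rewrite -e'].
  by rewrite AB.
have cKc : closed K by exact: compact_closed.
pose f x := if `[< K x >] then tau T0 x else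
  if `[< K' x >] then tau (binv T0) x else x.
have fs g : T0 g -> f (src G g) = rng G g.
  move=> Tg; rewrite /f asboolT; first by rewrite tau_slice.
  by rewrite KE; exists g.
have fr g : T0 g -> f (rng G g) = src G g.
  move=> Tg; rewrite /f asboolF; last first.
    by move=> /KK' nK; apply: nK; exists g.
  rewrite asboolT; last by exists g.
  rewrite -src_inv tau_slice ?rng_inv//; first exact: slice_inv.
  by exists g.
have fi x : ~ K x -> ~ K' x -> f x = x.
  by move=> nK nK'; rewrite /f !asboolF.
have fK : cancel f f.
  move=> x; case: (pselect (K x)) => [|nK].
    by rewrite KE => -[g Tg <-]; rewrite fs// fr.
  case: (pselect (K' x)) => [[g Tg <-]|nK']; first by rewrite fr// fs.
  by rewrite fi fi.
have [x|h hf] := glue_slices effG fK fK; last first.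
  have T0k : T0 k.
    by split; first split.
  by exists h; rewrite hf (fs _ T0k).
case: (pselect (K x)) => [|nK].
  rewrite KE => Kx; exists T0 => //; split=> // g Tg.
  by rewrite fs.
case: (pselect (K' x)) => [[g Tg <-]|nK'].
  exists (binv T0); last by exists (ginv g); [exists g|rewrite src_inv].
  split; first exact: slice_inv.
  by move=> _ [l Tl <-]; rewrite src_inv rng_inv fr.
have oC : open (~` K `&` ~` K') by apply: openI; exact: closed_openC.
exists (fg_set (1%g : F) `&` src G @^-1` (~` K `&` ~` K')).
  by apply: act_covers => // y [nKy nKy']; rewrite act1 fi.
have [l gl e] := act_src (1%g : F) x.
by exists l => //; split=> //=; rewrite e.
Qed.

Hypothesis minG : minimal G.
Hypothesis pX : no_isolated_point X.

(** Orbits are dense, and dense sets meet open sets in infinitely many points. *)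
Lemma mover x (O : set X) (E : seq X) : open O -> O !=set0 ->
  exists g : F, O (act g x) /\ act g x \notin E.
Proof.
move=> oO /(avoid_finite T2 (x :: E) pX oO) On.
have [|y [[Oy /= yE] [k sk rk]]] := minG x On.
  by apply: openI => //; exact: open_notin.
move: yE; rewrite in_cons negb_or => /andP[/eqP yx yE].
have [|g] := @arrow_full_group k; first by rewrite sk rk => /esym.
by rewrite sk rk => gx; exists g; rewrite gx.
Qed.

End Swap.

(** * Three-cycles and the alternating full group *)

Section Tricycles.
Variables (X : topologicalType) (G : etale_groupoid X).
Local Notation F := (full_group G).
Hypothesis effG : effective G.
Let T2 : hausdorff_space X := base_hausdorff G.
Implicit Types (g h t s v : full_group G) (x y z : X) (U V W Y : set X).
Local Open Scope group_scope.

Definition supported (g : F) (Y : set X) : Prop :=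
  forall x, act g x <> x -> Y x.

Lemma supported_fix g Y x : supported g Y -> ~ Y x -> act g x = x.
Proof. by move=> gY nY; apply: contrapT => /gY. Qed.

Lemma supportedS g Y Z : Y `<=` Z -> supported g Y -> supported g Z.
Proof. by move=> YZ gY x /gY /YZ. Qed.

Lemma supported1 Y : supported 1 Y.
Proof. by move=> x; rewrite act1. Qed.

Lemma supportedV g Y : supported g Y -> supported g^-1 Y.
Proof. by move=> gY x nx; apply: gY => e; apply: nx; rewrite -{1}e actK. Qed.

Lemma supportedM g h Y : supported g Y -> supported h Y -> supported (g * h) Y.
Proof.
move=> gY hY x; rewrite act_mul => nx; apply: contrapT => nY; apply: nx.
by rewrite (supported_fix hY nY) (supported_fix gY nY).
Qed.

Lemma supportedJ g h Y : supported g Y -> supported (g ^ h) (act h @^-1` Y).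
Proof.
move=> gY x; rewrite conjgE !act_mul => nx; apply: gY => e; apply: nx.
by rewrite e actK.
Qed.

Lemma supported_stable g Y x : supported g Y -> Y x -> Y (act g x).
Proof.
move=> gY Yx; case: (pselect (act g x = x)) => [->//|ne].
by apply: gY => /act_inj.
Qed.

Lemma compact_act g (U : set X) : compact U -> compact (act g @` U).
Proof.
move=> cU; apply: continuous_compact => //.
by apply: continuous_subspaceT; exact: act_continuous.
Qed.

Lemma act_preimage g (U : set X) : act g @^-1` U = act g^-1 @` U.
Proof.
apply/seteqP; split=> [x Ux|_ [y Uy <-]] /=; last by rewrite actKV.
by exists (act g x) => //; rewrite actK.
Qed.

Lemma open_preim g (U : set X) : open U -> open (act g @^-1` U).
Proof. by move=> oU; have /continuousP := @act_continuous X G g; apply. Qed.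

Lemma closed_preim g (U : set X) : closed U -> closed (act g @^-1` U).
Proof. by move=> oU; apply: closed_comp => // x _; exact: act_continuous. Qed.

Lemma open_moved (g : F) : open [set x | act g x <> x].
Proof.
rewrite openE => x /= ne; have [A [B [oA oB Ax Bx AB]]] := sep_points T2 ne.
rewrite /interior; have nA : nbhs x (act g @^-1` A).
  by apply: act_continuous; exact: open_nbhs_nbhs.
apply: filterS (filterI nA (open_nbhs_nbhs (conj oB Bx))) => y [/= Ay By] e.
suff : (A `&` B) y by rewrite AB.
by split=> //; rewrite -e.
Qed.

Lemma moved_conj (g h : F) x : act (g ^ h) x <> x <-> act g (act h x) <> act h x.
Proof.
rewrite conjgE !act_mul; split=> ne e; apply: ne; first by rewrite e actK.
by rewrite -{2}e actKV.
Qed.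

Lemma nontrivial_moves (g : F) : g <> 1 -> exists x, act g x <> x.
Proof.
move=> ng; apply: contrapT => nx; apply: ng; apply: act_faithful => // x.
by rewrite act1; apply: contrapT => ne; apply: nx; exists x.
Qed.

(** For g of order 3 this is the union of U, g U and g^2 U. *)
Definition cyc (g : F) (U : set X) : set X :=
  [set x | [\/ U x, U (act g x) | U (act g (act g x))]].

(** The three-cycles permuting U, g U and g^2 U, with the identity admitted for
    empty U, which makes the notion stable under cutting U into pieces. *)
Definition tricycle (g : F) (U : set X) : Prop :=
  [/\ open U, compact U, forall x, act g (act g (act g x)) = x,
      forall x, U x -> ~ U (act g x) & supported g (cyc g U)].

Lemma tricycle_notin2 g U x : tricycle g U -> U x -> ~ U (act g (act g x)).
Proof. by move=> [_ _ g3 gU _] Ux /gU; rewrite g3. Qed.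

Lemma tricycle_moves g U x : tricycle g U -> cyc g U x -> act g x <> x.
Proof.
move=> [_ _ g3 gU _] [|Ugx|Uggx] => [Ux|e|e].
- by move=> e; apply: (gU x Ux); rewrite e.
- by apply: (gU _ Ugx); rewrite !e; rewrite -e.
- by move: (gU _ Uggx); rewrite !e; apply; rewrite e in Uggx; rewrite e in Uggx.
Qed.

Lemma act_tricycleV g U x : tricycle g U -> act g^-1 x = act g (act g x).
Proof. by move=> [_ _ g3 _ _]; rewrite -{1}(g3 x) actK. Qed.

(** The support of a tricycle is closed as well as open. *)
Lemma tricycle_fix_near g U x : tricycle g U -> act g x = x ->
  nbhs x [set y | act g y = y].
Proof.
move=> tg e; have nC : ~ cyc g U x by move=> /(tricycle_moves tg).
have [oU cU _ _ gU] := tg; have clU := compact_closed T2 cU.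
have nU : ~ U x by move=> Ux; apply: nC; constructor 1.
have n1 : nbhs x (~` U) by apply: open_nbhs_nbhs; split=> //; exact: closed_openC.
have n2 : nbhs x (act g @^-1` (~` U)).
  by apply: act_continuous; rewrite e.
have n3 : nbhs x (act g @^-1` (act g @^-1` (~` U))).
  by apply: act_continuous; rewrite e.
apply: filterS (filterI n1 (filterI n2 n3)) => y [/= ? [? ?]].
by apply: (supported_fix gU) => -[].
Qed.

Lemma tricycle1 : tricycle 1 set0.
Proof.
split; [exact: open0|exact: compact0| | |exact: supported1] => // x.
by rewrite !act1.
Qed.

Lemma tricycleJ g U h : tricycle g U -> tricycle (g ^ h) (act h @^-1` U).
Proof.
move=> [oU cU g3 gU sU]; have aJ x : act h (act (g ^ h) x) = act g (act h x).
  by rewrite conjgE !act_mul actKV.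
split.
- exact: open_preim.
- by rewrite act_preimage; exact: compact_act.
- by move=> x; apply: (@act_inj _ _ h); rewrite !aJ g3.
- by move=> x /= Ux; rewrite aJ; exact: gU.
- move=> x nx; have /sU : act g (act h x) <> act h x by exact/moved_conj.
  by rewrite /cyc /= !aJ.
Qed.

Local Notation A := (alternating_full_group G).

Definition alt_on (Y : set X) : subgroup F :=
  generated [set g | exists2 U, tricycle g U & supported g Y].

Lemma alt_on_gen g U Y : tricycle g U -> supported g Y -> sg_set (alt_on Y) g.
Proof. by move=> tg gY; apply: sub_gen; exists U. Qed.

Lemma alt_onS Y Z : Y `<=` Z -> alt_on Y `<=` alt_on Z.
Proof.
by move=> YZ; apply: gen_monotone => g [U tg gY]; exists U => //; exact: supportedS gY.
Qed.

Lemma alt_on_supported Y g : sg_set (alt_on Y) g -> supported g Y.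
Proof.
have cl : group_closed [in [set g : F | supported g Y]].
  split=> [|x y]; rewrite ?inE /=; first exact: supported1.
  by move=> sx sy; apply: supportedM => //; exact: supportedV.
by move=> /(_ (Subgroup cl)); apply => h [U _].
Qed.

Lemma alt_onJ Y g h : sg_set (alt_on Y) g ->
  sg_set (alt_on (act h @^-1` Y)) (g ^ h).
Proof.
move=> Yg; apply/conj_subgroupE; move: g Yg; apply: gen_sub => g [U tg gY].
apply/conj_subgroupE; apply: (@alt_on_gen _ (act h @^-1` U)).
  exact: tricycleJ.
exact: supportedJ.
Qed.

Lemma tricycle_three g U : tricycle g U -> U !=set0 -> three_cycle g.
Proof.
move=> tg [x Ux]; have [oU cU g3 gU sU] := tg.
have gx : act g x <> x by apply: (tricycle_moves tg); constructor 1.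
split.
  split=> //.
    by apply: act_faithful => // y; rewrite expgS expg2 !act_mul g3 act1.
  move=> [|[|[|m]]]// _ e; apply: gx; first by rewrite -[g]expg1 e act1.
  by rewrite -[RHS]g3 -[X in _ = act g X]act_mul -expg2 e act1.
exists U, (act g @` U), (act g @` (act g @` U)).
have op V : open V -> open (act g @` V).
  by move=> oV; rewrite -[g]invgK -act_preimage; exact: open_preim.
split.
- by split=> //; do ?apply: compact_act.
- by split=> //; do ?apply: (op).
- split; rewrite -subset0.
  + by move=> z [Uz [y Uy e]]; apply: (gU y Uy); rewrite e.
  + move=> w [[y Uy <-] [_ [z Uz <-] /act_inj e]].
    by apply: (gU z Uz); rewrite e.
  + move=> y [Uy [_ [z Uz <-] e]].
    by apply: (tricycle_notin2 tg Uz); rewrite e.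
- split=> //; apply/seteqP; split=> [_ [_ [_ [y Uy <-] <-] <-]|y Uy].
    by rewrite g3.
  exists (act g (act g y)); last exact: g3.
  by exists (act g y) => //; exists y.
- move=> y ny; apply: (supported_fix sU) => -[] Uy; apply: ny.
  + by left; left.
  + right; exists (act g (act g y)); last exact: g3.
    by exists (act g y).
  + by left; right; exists (act g (act g y)); last exact: g3.
Qed.

Lemma tricycle_alternating g U : tricycle g U -> sg_set A g.
Proof.
move=> tg; have [U0|/set0P U0] := eqVneq U set0; last first.
  by apply: sub_gen; exact: tricycle_three U0.
have -> : g = 1; last exact: sg1.
apply: act_faithful => // x; rewrite act1.
by have [_ _ _ _ /(supported_fix)] := tg; apply; rewrite U0 => -[].
Qed.

Lemma three_tricycle g : three_cycle g -> exists U, tricycle g U.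
Proof.
move=> [[_ g3 _] [U1 [U2 [U3 [[c1 _ _] [o1 _ _] [d12 d23 d13] [e1 e2 e3] fx]]]]].
have a3 x : act g (act g (act g x)) = x.
  have := congr1 (fun k : F => act k x) g3.
  by rewrite /= act1 expgS expg2 !act_mul.
exists U1; split=> //.
  move=> x U1x U1g; suff : (U1 `&` U2) (act g x) by rewrite d12.
  by split=> //; rewrite -e1; exists x.
move=> x nx; apply: contrapT => nC; apply: nx; apply: fx => -[[U1x|]|].
- by apply: nC; constructor 1.
- rewrite -e1 => -[y U1y yx]; apply: nC; constructor 3.
  by rewrite -yx a3.
- rewrite -e2 -e1 => -[_ [y U1y <-] yx]; apply: nC; constructor 2.
  by rewrite -yx a3.
Qed.

Lemma alternating_alt_on : sg_set A = sg_set (alt_on setT).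
Proof.
apply/seteqP; split; apply: gen_sub => g.
  by move=> /three_tricycle [U tg]; exact: alt_on_gen tg _.
by move=> [U tg _]; exact: tricycle_alternating tg.
Qed.

End Tricycles.

(** * Building, restricting and cutting up three-cycles *)

Section Constructions.
Variables (X : topologicalType) (G : etale_groupoid X).
Local Notation F := (full_group G).
Hypothesis effG : effective G.
Let T2 : hausdorff_space X := base_hausdorff G.
Implicit Types (g h t v : full_group G) (x y z : X) (U V W Y : set X).
Local Open Scope group_scope.

Lemma clopen_preim_near g V x : open V -> compact V ->
  nbhs x [set y | V (act g y) <-> V (act g x)].
Proof.
move=> oV cV; have clV := compact_closed T2 cV.
exact: (clopen_near x (open_preim g oV) (closed_preim (g := g) clV)).
Qed.

(** The element rotating V -> g2 V -> g3 V -> V by g2, by g3 g2^-1 and by g3^-1. *)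
Lemma make_tricycle V g2 g3 : open V -> compact V ->
  (forall x, V x -> ~ V (act g2 x)) ->
  (forall x, V x -> ~ V (act g3 x)) ->
  (forall x y, V x -> V y -> act g2 x <> act g3 y) ->
  exists t, [/\ tricycle t V,
    forall x, V x -> [/\ act t x = act g2 x, act t (act g2 x) = act g3 x
                       & act t (act g3 x) = x] &
    forall y, act t y <> y ->
      exists2 x, V x & [\/ y = x, y = act g2 x | y = act g3 x]].
Proof.
move=> oV cV d2 d3 d23.
pose f x := if `[< V x >] then act g2 x else
  if `[< V (act g2^-1 x) >] then act g3 (act g2^-1 x) else
  if `[< V (act g3^-1 x) >] then act g3^-1 x else x.
have f1 x : V x -> f x = act g2 x by move=> Vx; rewrite /f asboolT.
have f2 x : V x -> f (act g2 x) = act g3 x.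
  by move=> Vx; rewrite /f asboolF ?asboolT// ?actK//; exact: d2.
have f3 x : V x -> f (act g3 x) = x.
  move=> Vx; rewrite /f asboolF; last exact: d3.
  rewrite asboolF; last first.
    by move=> Vy; apply: (d23 _ _ Vy Vx); rewrite actKV.
  by rewrite asboolT ?actK.
have f4 y : (forall x, V x -> [/\ y <> x, y <> act g2 x & y <> act g3 x]) ->
    f y = y.
  move=> ny; rewrite /f !asboolF// => /ny[] //; by rewrite actKV.
have fcase y : (exists2 x, V x & [\/ y = x, y = act g2 x | y = act g3 x]) \/
    f y = y.
  case: (pselect (exists2 x, V x & [\/ y = x, y = act g2 x | y = act g3 x])).
    by left.
  move=> ny; right; apply: f4 => x Vx; split=> e; apply: ny; exists x => //.
  - by constructor 1.
  - by constructor 2.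
  - by constructor 3.
have fff x : f (f (f x)) = x.
  have [[y Vy [] ->]|e] := fcase x; last by rewrite !e.
  - by rewrite (f1 _ Vy) (f2 _ Vy) (f3 _ Vy).
  - by rewrite (f2 _ Vy) (f3 _ Vy) (f1 _ Vy).
  - by rewrite (f3 _ Vy) (f1 _ Vy) (f2 _ Vy).
have [x|t tf] := @glue_acts _ _ effG f (f \o f) fff fff.
  have n1 := clopen_preim_near 1 x oV cV.
  have n2 := clopen_preim_near g2^-1 x oV cV.
  have n3 := clopen_preim_near g3^-1 x oV cV.
  pose k : F := if `[< V x >] then g2 else
    if `[< V (act g2^-1 x) >] then g3 * g2^-1 else
    if `[< V (act g3^-1 x) >] then g3^-1 else 1.
  exists k; apply: filterS (filterI n1 (filterI n2 n3)) => y [/= e1 [/= e2 e3]].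
  rewrite /f /k; rewrite !act1 in e1.
  case: (pselect (V x)) => V1; first by rewrite !asboolT//; exact/e1.
  rewrite !(asboolF V1) (asboolF (P := V y)); last by move/e1.
  case: (pselect (V (act g2^-1 x))) => V2.
    by rewrite !(asboolT V2) asboolT ?act_mul//; exact/e2.
  rewrite !(asboolF V2) (asboolF (P := V (act g2^-1 y))); last by move/e2.
  case: (pselect (V (act g3^-1 x))) => V3.
    by rewrite !(asboolT V3) asboolT//; exact/e3.
  by rewrite !(asboolF V3) asboolF ?act1//; move/e3.
exists t; split.
- split=> //.
  + by move=> x; rewrite !tf fff.
  + by move=> x Vx; rewrite tf f1//; exact: d2.
  + move=> x; rewrite /cyc /= !tf => nx; have [[y Vy [] e]|//] := fcase x.
    * by constructor 1; rewrite e.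
    * by constructor 3; rewrite e (f2 _ Vy) (f3 _ Vy).
    * by constructor 2; rewrite e (f3 _ Vy).
- by move=> x Vx; rewrite !tf (f1 _ Vx) (f2 _ Vx) (f3 _ Vx).
- by move=> y; rewrite tf => ny; have [//|//] := fcase y.
Qed.

Lemma restrict g C : open C -> closed C -> (forall x, C (act g x) <-> C x) ->
  exists t, (forall x, C x -> act t x = act g x) /\
            (forall x, ~ C x -> act t x = x).
Proof.
move=> oC cC gC; pose f x := if `[< C x >] then act g x else x.
pose f' x := if `[< C x >] then act g^-1 x else x.
have gC' x : C (act g^-1 x) <-> C x by rewrite -gC actKV.
have fT x : C x -> f x = act g x by move=> Cx; rewrite /f asboolT.
have fN x : ~ C x -> f x = x by move=> Cx; rewrite /f asboolF.
have fK : cancel f f'.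
  move=> x; rewrite /f' /f; case: (pselect (C x)) => Cx.
    by rewrite (asboolT Cx) asboolT ?actK//; exact/gC.
  by rewrite !(asboolF Cx).
have f'K : cancel f' f.
  move=> x; rewrite /f' /f; case: (pselect (C x)) => Cx.
    by rewrite (asboolT Cx) asboolT ?actKV//; exact/gC'.
  by rewrite !(asboolF Cx).
have [x|t tf] := @glue_acts _ _ effG f f' fK f'K.
  have n := clopen_near x oC cC; case: (pselect (C x)) => Cx.
    by exists g; apply: filterS n => y /= e; rewrite fT//; exact/e.
  by exists 1; apply: filterS n => y /= e; rewrite fN ?act1//; move/e.
by exists t; split=> x Cx; rewrite tf; [exact: fT|exact: fN].
Qed.

(** The part of the three-cycle v carried by the orbit of V. *)
Definition piece t v V : Prop :=
  (forall x, cyc v V x -> act t x = act v x) /\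
  (forall x, ~ cyc v V x -> act t x = x).

Lemma cyc_stable v U V x : tricycle v U -> cyc v V (act v x) <-> cyc v V x.
Proof.
move=> [_ _ v3 _ _]; rewrite /cyc /= v3.
by split=> -[]; [constructor 2|constructor 3|constructor 1|constructor 3
  |constructor 1|constructor 2].
Qed.

Lemma piece_tricycle t v U V : tricycle v U -> open V -> compact V -> V `<=` U ->
  piece t v V -> tricycle t V.
Proof.
move=> tv oV cV VU pt; have [_ _ v3 vU _] := tv; have [p1 p2] := pt.
have C1 x : V x -> cyc v V x by constructor 1.
split=> //.
- move=> x; case: (pselect (cyc v V x)) => [Cx|nC]; last by rewrite !p2.
  have Cv y : cyc v V y -> cyc v V (act v y) by move=> ?; exact/(cyc_stable _ _ tv).
  by rewrite (p1 _ Cx) (p1 _ (Cv _ Cx)) (p1 _ (Cv _ (Cv _ Cx))) v3.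
- by move=> x Vx /VU; rewrite p1; [exact/vU/VU|exact: C1].
- move=> x nx; have Cx : cyc v V x by apply: contrapT => /p2.
  by rewrite /cyc /= (p1 _ Cx) p1//; exact/(cyc_stable _ _ tv).
Qed.

Lemma piece_exists v U V : tricycle v U -> open V -> compact V -> V `<=` U ->
  exists t, piece t v V.
Proof.
move=> tv oV cV VU; have clV := compact_closed T2 cV.
have CE : cyc v V = V `|` act v @^-1` V `|` act (v * v) @^-1` V.
  apply/seteqP; split=> x; rewrite /cyc /= act_mul.
    by case; [left; left|left; right|right].
  by case=> [[]|]; [constructor 1|constructor 2|constructor 3].
have [|||t tP] := @restrict v (cyc v V); last by exists t.
- by rewrite CE; apply: openU; [apply: openU => //|]; exact: open_preim.
- by rewrite CE; apply: closedU; [apply: closedU => //|]; exact: closed_preim.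
- by move=> x; exact: cyc_stable tv.
Qed.

(** Two points of a v-orbit lying in U are equal, since U, v U and v^2 U are
    disjoint. *)
Lemma cyc_meet v U V W x : tricycle v U -> V `<=` U -> W `<=` U ->
  cyc v V x -> cyc v W x -> exists2 y, V y & W y.
Proof.
move=> tv VU WU; have n2 := tricycle_notin2 tv; have [_ _ v3 n1 _] := tv.
move=> [] a [] b; try by eexists; [exact: a|exact: b].
- by case: (n1 _ (VU _ a)); exact: WU.
- by case: (n2 _ (VU _ a)); exact: WU.
- by case: (n1 _ (WU _ b)); exact: VU.
- by case: (n1 _ (VU _ a)); exact: WU.
- by case: (n2 _ (WU _ b)); exact: VU.
- by case: (n1 _ (WU _ b)); exact: VU.
Qed.

Lemma piece_setU t t1 t2 v U V W : tricycle v U -> V `<=` U -> W `<=` U ->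
  V `&` W = set0 -> piece t1 v V -> piece t2 v W ->
  piece t v (V `|` W) -> t = t1 * t2.
Proof.
move=> tv VU WU d [p1 n1] [p2 n2] [p n].
have CU x : cyc v (V `|` W) x <-> cyc v V x \/ cyc v W x.
  rewrite /cyc /=; split=> [[] [] a|[[] a|[] a]].
  - by left; constructor 1.
  - by right; constructor 1.
  - by left; constructor 2.
  - by right; constructor 2.
  - by left; constructor 3.
  - by right; constructor 3.
  - by constructor 1; left.
  - by constructor 2; left.
  - by constructor 3; left.
  - by constructor 1; right.
  - by constructor 2; right.
  - by constructor 3; right.
have disj x : cyc v V x -> cyc v W x -> False.
  move=> a b; have [y Vy Wy] := cyc_meet tv VU WU a b.
  by have : (V `&` W) y by []; rewrite d.
apply: act_faithful => // x; rewrite act_mul.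
case: (pselect (cyc v W x)) => Wx.
  rewrite (p2 _ Wx) p; last by apply/CU; right.
  by rewrite n1// => /disj; apply; apply/(cyc_stable _ _ tv).
rewrite (n2 _ Wx); case: (pselect (cyc v V x)) => Vx.
  by rewrite (p1 _ Vx) p//; apply/CU; left.
by rewrite (n1 _ Vx) n// => /CU[].
Qed.

Hypothesis bX : compact_open_basis X.

(** By compactness U is a finite disjoint union of sets V small enough, and v is
    the product of the corresponding pieces. *)
Lemma tricycle_local (H : subgroup F) v U : tricycle v U ->
  (forall x, U x -> exists2 N, nbhs x N & forall V t, open V -> compact V ->
     V `<=` N -> V `<=` U -> piece t v V -> sg_set H t) ->
  sg_set H v.
Proof.
move=> tv loc; have [oU cU _ _ sU] := tv.
have {}loc x : exists K : set X, U x -> [/\ open K, compact K, K x &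
    forall V t, open V -> compact V -> V `<=` K -> V `<=` U -> piece t v V ->
    sg_set H t].
  case: (pselect (U x)) => [/loc [N nN NP]|nU]; last by exists set0.
  have [K [oK cK Kx KN]] := bX nN; exists K => _; split=> // V t oV cV VK.
  by apply: NP => //; apply: subset_trans KN.
have [K KP] := choice loc.
have pieces (s : seq X) : {in s, forall x, U x} -> forall V t, open V ->
    compact V -> V `<=` U -> (forall y, V y -> exists2 x, x \in s & K x y) ->
    piece t v V -> sg_set H t.
  elim: s => [|x s IH] sU' V t oV cV VU Vs pt.
    have -> : t = 1; last exact: sg1.
    apply: act_faithful => // y; rewrite act1; have [_] := pt; apply.
    by move=> -[] /Vs[].
  have Ux : U x by apply: sU'; rewrite mem_head.
  have [oK cK Kx HK] := KP x Ux; have clK := compact_closed T2 cK.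
  pose V1 := V `&` K x; pose V2 := V `&` ~` K x.
  have VE : V = V1 `|` V2 by rewrite -setIUr setUv setIT.
  have o1 : open V1 by exact: openI.
  have o2 : open V2 by apply: openI => //; exact: closed_openC.
  have c1 : compact V1 by apply: compact_closedI.
  have c2 : compact V2 by apply: compact_closedI => //; exact: open_closedC.
  have V1U : V1 `<=` U by move=> y [/VU].
  have V2U : V2 `<=` U by move=> y [/VU].
  have [t1 pt1] := piece_exists tv o1 c1 V1U.
  have [t2 pt2] := piece_exists tv o2 c2 V2U.
  rewrite VE in pt; have -> : t = t1 * t2.
    apply: piece_setU tv V1U V2U _ pt1 pt2 pt.
    by rewrite setIACA setICr setI0.
  apply: sgM; first by apply: HK pt1 => // y [].
  apply: (IH _ V2 t2 o2 c2 V2U _ pt2) => [y ys|y [/Vs [z + Kz] nK]].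
    by apply: sU'; rewrite in_cons ys orbT.
  rewrite in_cons => /orP[/eqP zx|zs]; first by rewrite -zx in nK.
  by exists z.
(* Finite lists of points of U ordered by inclusion: compactness yields one list
   whose sets K x cover U. *)
pose Ffin : set_system (seq X) := filter_from
    [set s : seq X | {in s, forall x, U x}]
  (fun s : seq X => [set s' : seq X | {subset s <= s'}]).
have FF : Filter Ffin.
  apply: filter_from_filter; first by exists [::].
  move=> s1 s2 U1 U2; exists (s1 ++ s2).
    by move=> x; rewrite mem_cat => /orP[/U1|/U2].
  by move=> s s12; split=> x xs; apply: s12; rewrite mem_cat xs ?orbT.
have [|s sU' sUK] := (compact_near_coveringP U).1 cU _ Ffin
    (fun (s : seq X) y => exists2 x, x \in s & K x y) FF.
  move=> x Ux; have [oK _ Kx _] := KP x Ux.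
  exists (K x, [set s : seq X | x \in s]); last first.
    by move=> [y s] [/= Ky xs]; exists x.
  split=> /=; first exact: open_nbhs_nbhs.
  exists [:: x] => [y|s xs] /=; first by rewrite inE => /eqP ->.
  by apply: xs; rewrite mem_head.
apply: (pieces s sU' U v) => //; first exact: (sUK s).
split=> x; first by [].
exact: supported_fix.
Qed.

(** Distinct images of one point stay apart on a whole neighbourhood; applied to a
    list of elements it makes a finite pattern of points into a pattern of disjoint
    clopen sets. *)
Lemma separating_nbhs (gs : seq F) x : exists2 N, nbhs x N &
  {in gs &, forall g h, act g x <> act h x ->
     forall y z, N y -> N z -> act g y <> act h z}.
Proof.
have pairs (ps : seq (F * F)) : exists2 N, nbhs x N &
    {in ps, forall p, act p.1 x <> act p.2 x ->
      forall y z, N y -> N z -> act p.1 y <> act p.2 z}.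
  elim: ps => [|[g h] ps [N nN IH]]; first by exists setT => //; exact: filterT.
  case: (pselect (act g x = act h x)) => [e|/(sep_points T2)].
    exists N => // p; rewrite in_cons => /orP[/eqP-> //|]; exact: IH.
  move=> [A [B [oA oB Ax Bx AB]]].
  have nA : nbhs x (act g @^-1` A).
    by apply: act_continuous; exact: open_nbhs_nbhs.
  have nB : nbhs x (act h @^-1` B).
    by apply: act_continuous; exact: open_nbhs_nbhs.
  exists (N `&` (act g @^-1` A `&` act h @^-1` B)); first exact: filterI nN (filterI nA nB).
  move=> p; rewrite in_cons => /orP[/eqP-> /= _|pps ne] y z [Ny [/= gy hy]] [Nz [/= gz hz]].
    by move=> e; have : (A `&` B) (act g y); [split=> //; rewrite e|rewrite AB].
  exact: IH pps ne _ _ Ny Nz.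
have [N nN NP] := pairs [seq (g, h) | g <- gs, h <- gs].
exists N => // g h gg hg; apply: (NP (g, h)).
by apply/allpairsP; exists (g, h).
Qed.

End Constructions.

(** * Forcing, and three-cycles as commutators *)

(** A member r of P such that r ^ (b * c) avoids H for all c below some condition U
    can be discarded after replacing everything by its conjugate under b.  As P
    always has a conjugate meeting H, this stops at some s which no condition can
    push out of H.  The property Good records what the conditions must leave room
    for.  This replaces covering arguments by cosets of subgroups of finite index. *)
Lemma forcing (K : groupType) (T : Type) (le : T -> T -> Prop) (B : T -> set K)
    (Good : seq K -> T -> Prop) (H : subgroup K) (P : seq K) (W : T) :
  (forall V, B V 1%g) ->
  (forall V g h, B V g -> B V h -> B V (g * h)%g) ->
  (forall U V, le U V -> B U `<=` B V) ->
  Good P W ->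
  (forall b, B W b -> exists2 r, r \in P & sg_set H (r ^ b)%g) ->
  exists s R V, Good (s :: R) V /\
    forall b U, B V b -> le U V -> Good [seq (r ^ b)%g | r <- R] U ->
      exists2 c, B U c & sg_set H (s ^ (b * c))%g.
Proof.
move=> B1 BM Ble; move: {2}(size P) (erefl (size P)) => n.
elim: n P W => [|n IH] P W sP GP PH.
  have [r] := PH 1%g (B1 W).
  by rewrite (size0nil sP).
case: P sP GP PH => [//|s R] [sR] GP PH.
case: (pselect (forall b U, B W b -> le U W ->
    Good [seq (r ^ b)%g | r <- R] U ->
    exists2 c, B U c & sg_set H (s ^ (b * c))%g)) => [yes|no].
  by exists s, R, W.
have {no} [b [U [Wb UW GU nH]]] : exists b U, [/\ B W b, le U W,
    Good [seq (r ^ b)%g | r <- R] U &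
    forall c, B U c -> ~ sg_set H (s ^ (b * c))%g].
  apply: contrapT => nex; apply: no => b U Wb UW GU; apply: contrapT => nc.
  apply: nex; exists b, U; split=> // c Uc Hc; apply: nc; by exists c.
apply: (IH [seq (r ^ b)%g | r <- R] U) => //; first by rewrite size_map.
move=> c Uc; have [|r] := PH (b * c)%g; first by apply: BM => //; exact: Ble Uc.
rewrite in_cons => /orP[/eqP ->|rR Hr]; first by move=> /(nH c Uc).
by exists (r ^ b)%g; [exact: map_f|rewrite -conjgM].
Qed.

Section Commutators.
Variables (X : topologicalType) (G : etale_groupoid X).
Local Notation F := (full_group G).
Local Notation A := (alternating_full_group G).
Hypothesis effG : effective G.
Hypothesis bX : compact_open_basis X.
Hypothesis minG : minimal G.
Hypothesis pX : no_isolated_point X.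
Let T2 : hausdorff_space X := base_hausdorff G.
Implicit Types (g h t s v : full_group G) (x y z : X) (U V W Y M : set X).
Local Open Scope group_scope.

(** The rigid stabiliser of W in the alternating full group. *)
Definition rigid W : set F := [set g | sg_set A g /\ supported g W].

Lemma rigid1 W : rigid W 1.
Proof. by split; [exact: sg1|exact: supported1]. Qed.

Lemma rigidM W g h : rigid W g -> rigid W h -> rigid W (g * h).
Proof. by move=> [Ag sg] [Ah sh]; split; [exact: sgM|exact: supportedM]. Qed.

Lemma rigidS V W : V `<=` W -> rigid V `<=` rigid W.
Proof. by move=> VW g [Ag sg]; split=> //; exact: supportedS sg. Qed.

Lemma tricycle_rigid g U W : tricycle g U -> supported g W -> rigid W g.
Proof. by move=> tg sg; split=> //; exact: tricycle_alternating tg. Qed.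

(** What [make_tricycle] provides: t is the three-cycle V -> g2 V -> g3 V -> V. *)
Definition rotates t V g2 g3 : Prop := [/\ tricycle t V,
    forall x, V x -> [/\ act t x = act g2 x, act t (act g2 x) = act g3 x
                       & act t (act g3 x) = x] &
    forall y, act t y <> y ->
      exists2 x, V x & [\/ y = x, y = act g2 x | y = act g3 x]].

Lemma rotates_fix t V g2 g3 y : rotates t V g2 g3 ->
  (forall x, V x -> [/\ y <> x, y <> act g2 x & y <> act g3 x]) -> act t y = y.
Proof.
move=> [_ _ ft] ny; apply: contrapT => /ft [x /ny[? ? ?] []] //.
Qed.

Lemma rotates_supported t V g2 g3 W : rotates t V g2 g3 ->
  (forall x, V x -> [/\ W x, W (act g2 x) & W (act g3 x)]) -> supported t W.
Proof. by move=> [_ _ ft] VW y /ft [x /VW[? ? ?] []] ->. Qed.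

Lemma local_tricycle x g2 g3 : act g2 x <> x -> act g3 x <> x ->
  act g2 x <> act g3 x -> exists2 N, nbhs x N & forall V, open V -> compact V ->
    V `<=` N -> exists t, rotates t V g2 g3.
Proof.
move=> d2 d3 d23; have [N nN NP] := separating_nbhs [:: 1; g2; g3] x.
exists N => // V oV cV VN; apply: make_tricycle => //.
- move=> y Vy Vy2; apply: (NP g2 1) (VN _ Vy) (VN _ Vy2) _;
    by rewrite ?inE ?eqxx ?orbT ?act1.
- move=> y Vy Vy2; apply: (NP g3 1) (VN _ Vy) (VN _ Vy2) _;
    by rewrite ?inE ?eqxx ?orbT ?act1.
- by move=> y z Vy Vz; apply: NP; rewrite ?inE ?eqxx ?orbT//; apply: VN.
Qed.

Lemma tricycle_at x g2 g3 N : act g2 x <> x -> act g3 x <> x ->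
  act g2 x <> act g3 x -> nbhs x N ->
  exists V t, [/\ open V, V x, V `<=` N & rotates t V g2 g3].
Proof.
move=> d2 d3 d23 nN; have [N' nN' NP] := local_tricycle d2 d3 d23.
have [V [oV cV Vx VN]] := bX (filterI nN nN').
have [|t rt] := NP V oV cV; first by move=> y /VN[].
by exists V, t; split=> // y /VN[].
Qed.

(** Over a small V the three-cycle on V, v V, v^2 V is the commutator of
    three-cycles on the places 1, 2, 4 and 1, 3, 5.  Their supports share the place
    1 only, so a three-cycle on the places 1, 6, 7 moves one support off the other. *)
Lemma tricycles_of_commutators (H : subgroup F) M : open M ->
  (forall t s g, rigid M t -> rigid M s -> rigid M g ->
    (forall x, act s x <> x -> act t (act g x) = act g x) ->
    sg_set H (t * s * t^-1 * s^-1)) ->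
  forall v U, tricycle v U -> supported v M -> sg_set H v.
Proof.
move=> oM HM v U tv vM; apply: (tricycle_local effG bX tv) => x Ux.
have [oU cU v3 vU sU] := tv.
have UM y : U y -> M y by move=> Uy; apply/vM/(tricycle_moves tv); constructor 1.
have Mx := UM x Ux; have Mv y : M y -> M (act v y) by exact: supported_stable.
have mv (E : seq X) : exists g, M (act g x) /\ act g x \notin E.
  by apply: (mover effG bX minG pX) => //; exists x.
have [p4 [M4]] := mv [:: x; act v x; act v (act v x)].
rewrite !inE !negb_or => /and3P[/eqP n40 /eqP n41 /eqP n42].
have [p5 [M5]] := mv [:: x; act v x; act v (act v x); act p4 x].
rewrite !inE !negb_or => /and4P[/eqP n50 /eqP n51 /eqP n52 /eqP n54].
have [p6 [M6]] := mv [:: x; act v x; act v (act v x); act p4 x; act p5 x].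
rewrite !inE !negb_or => /and5P[/eqP n60 /eqP n61 /eqP n62 /eqP n64 /eqP n65].
have [p7 [M7]] := mv [:: x; act v x; act v (act v x); act p4 x; act p5 x; act p6 x].
rewrite !inE !negb_or => /and5P[/eqP n70 /eqP n71 /eqP n72 /eqP n74].
move=> /andP[/eqP n75 /eqP n76].
have n10 : act v x <> x by move=> e; apply: (vU x Ux); rewrite e.
have vvx y : U y -> act v (act v y) <> y.
  by move=> Uy e; apply: (tricycle_notin2 tv Uy); rewrite e.
have n20 := vvx _ Ux.
have n21 : act v (act v x) <> act v x by move=> /act_inj.
pose w := v * v; have wE y : act w y = act v (act v y) by exact: act_mul.
have [N nN NP] := separating_nbhs [:: 1; v; w; p4; p5; p6; p7] x.
have [N' nN' MN'] : exists2 N', nbhs x N' & forall y, N' y ->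
    [/\ M (act p4 y), M (act p5 y), M (act p6 y) & M (act p7 y)].
  have nM p : M (act p x) -> nbhs x (act p @^-1` M).
    by move=> Mp; apply: act_continuous; exact: open_nbhs_nbhs.
  exists ((act p4 @^-1` M `&` act p5 @^-1` M) `&` (act p6 @^-1` M `&` act p7 @^-1` M)).
    by apply: filterI; apply: filterI; exact: nM.
  by move=> y [[? ?] [? ?]]; split.
exists (N `&` N'); first exact: filterI.
move=> V t0 oV cV VN VU pt0.
(* The seven places: the images of V under 1, v, w = v^2, p4, p5, p6, p7. *)
have sep g h : g \in [:: 1; v; w; p4; p5; p6; p7] ->
    h \in [:: 1; v; w; p4; p5; p6; p7] -> act g x <> act h x ->
    forall y z, V y -> V z -> act g y <> act h z.
  by move=> gi hi ne y z /VN[Ny _] /VN[Nz _]; exact: NP.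
have s1 h : h \in [:: 1; v; w; p4; p5; p6; p7] -> x <> act h x ->
    forall y z, V y -> V z -> y <> act h z.
  move=> hi ne y z Vy Vz e.
  by apply: (@sep 1 h _ hi _ y z Vy Vz); rewrite ?act1 ?inE ?eqxx.
have [t rt] : exists t, rotates t V v p4.
  apply: make_tricycle => //.
  - by move=> y Vy Vvy; apply: (s1 v) Vvy Vy _; rewrite ?inE ?eqxx ?orbT//; exact/nesym.
  - by move=> y Vy Vvy; apply: (s1 p4) Vvy Vy _; rewrite ?inE ?eqxx ?orbT//; exact/nesym.
  - by apply: sep; rewrite ?inE ?eqxx ?orbT//; exact/nesym.
have [s rs] : exists s, rotates s V w p5.
  apply: make_tricycle => //.
  - move=> y Vy Vvy; apply: (s1 w) Vvy Vy _; rewrite ?inE ?eqxx ?orbT// wE; exact/nesym.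
  - by move=> y Vy Vvy; apply: (s1 p5) Vvy Vy _; rewrite ?inE ?eqxx ?orbT//; exact/nesym.
  - by apply: sep; rewrite ?inE ?eqxx ?orbT// wE; exact/nesym.
have [g rg] : exists g, rotates g V p6 p7.
  apply: make_tricycle => //.
  - by move=> y Vy Vvy; apply: (s1 p6) Vvy Vy _; rewrite ?inE ?eqxx ?orbT//; exact/nesym.
  - by move=> y Vy Vvy; apply: (s1 p7) Vvy Vy _; rewrite ?inE ?eqxx ?orbT//; exact/nesym.
  - by apply: sep; rewrite ?inE ?eqxx ?orbT//; exact/nesym.
have VM y : V y -> [/\ M y, M (act v y), M (act w y) & [/\ M (act p4 y),
    M (act p5 y), M (act p6 y) & M (act p7 y)]].
  move=> Vy; have My := UM _ (VU _ Vy); have [_ /MN' ?] := VN _ Vy.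
  split=> //; first exact: Mv.
  by rewrite wE; exact/Mv/Mv.
have I : [/\ v \in [:: 1; v; w; p4; p5; p6; p7], w \in [:: 1; v; w; p4; p5; p6; p7],
   p4 \in [:: 1; v; w; p4; p5; p6; p7] & [/\ p5 \in [:: 1; v; w; p4; p5; p6; p7],
   p6 \in [:: 1; v; w; p4; p5; p6; p7] & p7 \in [:: 1; v; w; p4; p5; p6; p7]]].
  by rewrite !inE !eqxx !orbT.
have [iv iw i4 [i5 i6 i7]] := I.
have fixout k g2 g3 h : rotates k V g2 g3 ->
    g2 \in [:: 1; v; w; p4; p5; p6; p7] -> g3 \in [:: 1; v; w; p4; p5; p6; p7] ->
    h \in [:: 1; v; w; p4; p5; p6; p7] ->
    x <> act h x -> act g2 x <> act h x -> act g3 x <> act h x ->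
    forall y, V y -> act k (act h y) = act h y.
  move=> rk i2 i3 ih ne ne2 ne3 y Vy; apply: (rotates_fix rk) => z Vz.
  split; first by apply/nesym; exact: (s1 h).
  - by apply: sep => //; exact/nesym.
  - by apply: sep => //; exact/nesym.
have [tt t1 _] := rt; have [ts s2 fs] := rs; have [tg g1 _] := rg.
have [pC pN] := pt0.
have t0v y : V y -> act t0 y = act v y by move=> Vy; apply: pC; constructor 1.
have t0w y : V y -> act t0 (act v y) = act w y.
  by move=> Vy; rewrite wE; apply: pC; constructor 3; rewrite v3.
have t0x y : V y -> act t0 (act w y) = y.
  by move=> Vy; rewrite wE pC ?v3//; constructor 2; rewrite v3.
have t0out h : h \in [:: 1; v; w; p4; p5; p6; p7] -> x <> act h x ->
    act v x <> act h x -> act w x <> act h x ->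
    forall y, V y -> act t0 (act h y) = act h y.
  move=> ih ne nev new y Vy; apply: pN => -[] Vz.
  - by apply: (s1 h ih ne _ _ Vz Vy).
  - by apply: (sep w h iw _ _ _ _ Vz Vy) => //; rewrite wE v3.
  - by apply: (sep v h iv _ _ _ _ Vz Vy) => //; rewrite v3.
rewrite -wE in n20 n21 n42 n52 n62 n72.
have tw y : V y -> act t (act w y) = act w y by apply: (fixout _ _ _ _ rt) => //; exact/nesym.
have t5 y : V y -> act t (act p5 y) = act p5 y by apply: (fixout _ _ _ _ rt) => //; exact/nesym.
have t6 y : V y -> act t (act p6 y) = act p6 y by apply: (fixout _ _ _ _ rt) => //; exact/nesym.
have sv y : V y -> act s (act v y) = act v y by apply: (fixout _ _ _ _ rs) => //; exact/nesym.
have s4 y : V y -> act s (act p4 y) = act p4 y by apply: (fixout _ _ _ _ rs) => //; exact/nesym.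
have gw y : V y -> act g (act w y) = act w y by apply: (fixout _ _ _ _ rg) => //; exact/nesym.
have g5 y : V y -> act g (act p5 y) = act p5 y by apply: (fixout _ _ _ _ rg) => //; exact/nesym.
have t04 y : V y -> act t0 (act p4 y) = act p4 y by apply: t0out => //; exact/nesym.
have t05 y : V y -> act t0 (act p5 y) = act p5 y by apply: t0out => //; exact/nesym.
suff -> : t0 = t * s * t^-1 * s^-1.
  apply: (HM t s g).
  - apply: tricycle_rigid tt _; apply: (rotates_supported rt) => y /VM.
    by move=> [? ? ? []].
  - apply: tricycle_rigid ts _; apply: (rotates_supported rs) => y /VM.
    by move=> [? ? ? []].
  - apply: tricycle_rigid tg _; apply: (rotates_supported rg) => y /VM.
    by move=> [? ? ? []].
  - move=> y /fs [z Vz [] ->].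
    + by have [-> _ _] := g1 z Vz; exact: t6.
    + by rewrite gw// tw.
    + by rewrite g5// t5.
(* Multiplied out, to avoid computing with inverses. *)
suff e : t0 * (s * t) = t * s by rewrite -e !mulgA !mulgK.
apply: act_faithful => // y; rewrite !act_mul.
case: (pselect (exists2 z, V z & [\/ y = z, y = act v z, y = act w z |
    (y = act p4 z \/ y = act p5 z)])) => [[z Vz]|ny].
  have [a1 a2 a3] := t1 z Vz; have [b1 b2 b3] := s2 z Vz.
  move=> [->|->|->|[]->].
  - by rewrite a1 sv// t0w// b1 tw.
  - by rewrite a2 s4// t04// sv// a2.
  - by rewrite tw// b2 t05// t5.
  - by rewrite a3 b1 t0x// s4// a3.
  - by rewrite t5// b3 t0v// a1.
have fy k g2 g3 : rotates k V g2 g3 ->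
    g2 \in [:: v; w; p4; p5] -> g3 \in [:: v; w; p4; p5] -> act k y = y.
  have nyg h : h \in [:: v; w; p4; p5] -> forall z, V z -> y <> act h z.
    move=> hi z Vz e; apply: ny; exists z => //; move: hi e.
    rewrite !inE => /or4P[]/eqP->; do ?by [constructor 2|constructor 3|].
      by constructor 4; left.
    by constructor 4; right.
  move=> rk i2 i3; apply: (rotates_fix rk) => z Vz; split.
  - by move=> e; apply: ny; exists z => //; constructor 1.
  - exact: nyg.
  - exact: nyg.
rewrite (fy t v p4)// ?inE ?eqxx ?orbT//.
rewrite (fy s w p5)// ?inE ?eqxx ?orbT//.
rewrite (fy t v p4)// ?inE ?eqxx ?orbT//.
apply: pN => -[] Vz; apply: ny.
- by exists y => //; constructor 1.
- by exists (act v y) => //; constructor 3; rewrite wE v3.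
- by exists (act v (act v y)) => //; constructor 2; rewrite v3.
Qed.

End Commutators.

(** * Localising a confined subgroup *)

Section SepLists.
Variable X : topologicalType.
Hypothesis T2 : hausdorff_space X.

Lemma sep_seqs (A B : seq X) : (forall x, x \in A -> x \notin B) ->
  exists U V : set X, [/\ open U, open V, {in A, forall x, U x},
    {in B, forall x, V x} & U `&` V = set0].
Proof.
have pt (a : X) (C : seq X) : a \notin C -> exists U V : set X,
    [/\ open U, open V, U a, {in C, forall x, V x} & U `&` V = set0].
  elim: C => [_|b C IH].
    by exists setT, set0; split=> //; [exact: openT|exact: open0|rewrite setI0].
  rewrite in_cons negb_or => /andP[/eqP ab /IH [U [V [oU oV Ua CV UV]]]].
  have [U' [V' [oU' oV' U'a V'b UV']]] := sep_points T2 ab.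
  exists (U `&` U'), (V `|` V'); split; [exact: openI|exact: openU|by []| |].
    by move=> x; rewrite in_cons => /orP[/eqP->|/CV]; [right|left].
  rewrite -subset0 => x [[Ux U'x] [Vx|V'x]]; first by rewrite -UV.
  by rewrite -UV'.
elim: A => [_|a A IH dAB].
  by exists set0, setT; split=> //; [exact: open0|exact: openT|rewrite set0I].
have [x xA|U [V [oU oV AU BV UV]]] := IH.
  by apply: dAB; rewrite in_cons xA orbT.
have [|U' [V' [oU' oV' U'a BV' UV']]] := pt a B.
  by apply: dAB; rewrite mem_head.
exists (U `|` U'), (V `&` V'); split; [exact: openU|exact: openI| | |].
- by move=> x; rewrite in_cons => /orP[/eqP->|/AU]; [right|left].
- by move=> x xB; split; [exact: BV|exact: BV'].
- rewrite -subset0 => x [[Ux|U'x] [Vx V'x]]; first by rewrite -UV.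
  by rewrite -UV'.
Qed.

End SepLists.

Section Localisation.
Variables (X : topologicalType) (G : etale_groupoid X).
Local Notation F := (full_group G).
Local Notation A := (alternating_full_group G).
Hypothesis effG : effective G.
Hypothesis bX : compact_open_basis X.
Hypothesis minG : minimal G.
Hypothesis pX : no_isolated_point X.
Let T2 : hausdorff_space X := base_hausdorff G.
Implicit Types (g h k t s u v b c j r a : full_group G) (x y z : X) (U V W Y M O : set X).
Local Open Scope group_scope.

(** A point moved by h but not by k stays in the fixed set of k under h, unless the
    two supports interfere there. *)
Lemma commute_off h k (S : set X) : (forall x, S (act h x) -> S x) ->
  (forall x, S (act k x) -> S x) ->
  (forall x, act h x <> x -> act k x <> x -> S x) ->
  forall x, ~ S x -> act h (act k x) = act k (act h x).
Proof.
move=> Sh Sk hk x nS.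
case: (pselect (act h x = x)) => hx; last first.
  rewrite (_ : act k x = x); last by apply: contrapT => kx; exact/nS/hk.
  apply/esym; apply: contrapT => kx; apply/nS/Sh/hk => //.
  by move=> /act_inj.
rewrite hx; apply: contrapT => hkx; apply: nS; apply: Sk; apply: hk => //.
by move=> /act_inj kx; apply: hkx; rewrite kx hx.
Qed.

(** On M the middle factor s^-1 (b0 b1^-1) s of the quotient acts trivially, as s
    moves M off itself; on s^-1 M only this middle factor acts.  The corrections
    c0 and c1 live elsewhere and affect neither place. *)
Lemma quotient_of_conjugates M Z O O' s b0 b1 c0 c1 :
  supported b0 M -> supported b1 M -> supported c0 Z -> supported c1 Z ->
  (forall x, M x -> O x /\ O (act s^-1 x)) ->
  (forall x, Z x -> O' x /\ O' (act s^-1 x)) ->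
  O `&` O' = set0 -> (forall x, M x -> ~ M (act s x)) ->
  let h := (s ^ (b0 * c0))^-1 * s ^ (b1 * c1) in
  [/\ forall x, M x -> act h x = act b0^-1 (act b1 x),
      forall x, M x -> act h (act s^-1 x) = act s^-1 (act b0 (act b1^-1 x)) &
      forall x, ~ M x -> ~ M (act s x) -> ~ O' x -> act h x = x].
Proof.
move=> b0M b1M c0Z c1Z MO ZO OO' Ms h.
have hE x : act h x = act c0^-1 (act b0^-1 (act s^-1 (act b0 (act c0
    (act c1^-1 (act b1^-1 (act s (act b1 (act c1 x))))))))).
  by rewrite /h !conjgE !(invgM, invgK, act_mul).
have OnO' x : O x -> ~ O' x by move=> Ox O'x; suff : (O `&` O') x by rewrite OO'.
have MZ x : M x -> ~ Z x by move=> /MO[/OnO' nO' _] /ZO[].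
have MsZ x : M x -> ~ Z (act s^-1 x) by move=> /MO[_ /OnO' nO'] /ZO[].
have MZs x : M x -> ~ Z (act s x).
  by move=> /MO[/OnO' nO' _] /ZO[_]; rewrite actK.
have MsM x : M x -> ~ M (act s^-1 x) by move=> Mx /Ms; rewrite actKV.
have fb k x : supported k M -> ~ M x -> act k x = x /\ act k^-1 x = x.
  by move=> sk nM; split; apply: supported_fix nM => //; exact: supportedV.
have fc k x : supported k Z -> ~ Z x -> act k x = x /\ act k^-1 x = x.
  by move=> sk nM; split; apply: supported_fix nM => //; exact: supportedV.
have st k x : supported k M -> M x -> M (act k x) by exact: supported_stable.
have stV k x : supported k M -> M x -> M (act k^-1 x).
  by move=> /supportedV; exact: supported_stable.
split=> x Mx.
- have M1 := st _ _ b1M Mx; have nM := Ms _ M1; have nZ := MZs _ M1.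
  rewrite hE (fc _ _ c1Z (MZ _ Mx)).1 (fb _ _ b1M nM).2 (fc _ _ c1Z nZ).2.
  rewrite (fc _ _ c0Z nZ).1 (fb _ _ b0M nM).1 actK.
  by rewrite (fc _ _ c0Z (MZ _ (stV _ _ b0M M1))).2.
- have M1 := stV _ _ b1M Mx; have M0 := st _ _ b0M M1.
  rewrite hE (fc _ _ c1Z (MsZ _ Mx)).1 (fb _ _ b1M (MsM _ Mx)).1 actKV.
  rewrite (fc _ _ c1Z (MZ _ M1)).2 (fc _ _ c0Z (MZ _ M1)).1.
  by rewrite (fb _ _ b0M (MsM _ M0)).2 (fc _ _ c0Z (MsZ _ M0)).2.
- move=> nMs nO'; have nZ : ~ Z x by move=> /ZO[].
  have nZs : ~ Z (act s x) by move=> /ZO[_]; rewrite actK.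
  rewrite hE (fc _ _ c1Z nZ).1 (fb _ _ b1M Mx).1 (fb _ _ b1M nMs).2.
  rewrite (fc _ _ c1Z nZs).2 (fc _ _ c0Z nZs).1 (fb _ _ b0M nMs).1 actK.
  by rewrite (fb _ _ b0M Mx).2 (fc _ _ c0Z nZ).2.
Qed.

(** The first quotient acts as t on M and as a conjugate of t^-1 on s^-1 M, the
    second one as u and as a conjugate of g u^-1 g^-1.  The latter commutes with t,
    so the commutator is trivial on s^-1 M; off both places the supports of the two
    quotients are disjoint. *)
Lemma commutator_of_quotients M Z Z' O O1 O2 s t u g c0 c1 c2 c3 :
  supported t M -> supported u M -> supported g M ->
  supported c0 Z -> supported c1 Z -> supported c2 Z' -> supported c3 Z' ->
  (forall x, M x -> O x /\ O (act s^-1 x)) ->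
  (forall x, Z x -> O1 x /\ O1 (act s^-1 x)) ->
  (forall x, Z' x -> O2 x /\ O2 (act s^-1 x)) ->
  O `&` O1 = set0 -> O `&` O2 = set0 -> O1 `&` O2 = set0 ->
  (forall x, M x -> ~ M (act s x)) ->
  (forall x, act u x <> x -> act t (act g x) = act g x) ->
  let h := (s ^ (1 * c0))^-1 * s ^ (t * c1) in
  let k := (s ^ (g * c2))^-1 * s ^ (g * u * c3) in
  t * u * t^-1 * u^-1 = h * k * h^-1 * k^-1.
Proof.
move=> tM uM gM c0Z c1Z c2Z c3Z MO ZO Z'O OO1 OO2 O12 Ms tgu h k.
have guM : supported (g * u) M by exact: supportedM.
have [h1 h2 h3] := quotient_of_conjugates (supported1 M) tM c0Z c1Z MO ZO OO1 Ms.
have [k1 k2 k3] := quotient_of_conjugates gM guM c2Z c3Z MO Z'O OO2 Ms.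
have [h1' h2' _] := quotient_of_conjugates tM (supported1 M) c1Z c0Z MO ZO OO1 Ms.
have [k1' k2' _] := quotient_of_conjugates guM gM c3Z c2Z MO Z'O OO2 Ms.
rewrite -/h in h1 h2 h3; rewrite -/k in k1 k2 k3.
have hV : (s ^ (t * c1))^-1 * s ^ (1 * c0) = h^-1 by rewrite -[LHS]invgK invgM invgK.
have kV : (s ^ (g * u * c3))^-1 * s ^ (g * c2) = k^-1 by rewrite -[LHS]invgK invgM invgK.
rewrite hV in h1' h2'; rewrite kV in k1' k2'.
clear hV kV; clearbody h k.
have st j x : supported j M -> M x -> M (act j x) by exact: supported_stable.
have stV j x : supported j M -> M x -> M (act j^-1 x).
  by move=> /supportedV; exact: supported_stable.
pose S x := M x \/ M (act s x).
have stabV j b0 b1 : supported b0 M -> supported b1 M ->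
    (forall x, M x -> act j^-1 x = act b0^-1 (act b1 x)) ->
    (forall x, M x -> act j^-1 (act s^-1 x) = act s^-1 (act b0 (act b1^-1 x))) ->
    forall x, S (act j x) -> S x.
  move=> sb0 sb1 j1 j2 x [/[dup] Mj|Mj].
    by move=> /j1; rewrite actK => ->; left; apply/stV/st.
  have := j2 _ Mj; rewrite !actK => ->; right; rewrite actKV.
  exact/st/stV.
have Sh := stabV _ _ _ tM (supported1 M) h1' h2'.
have Sk := stabV _ _ _ guM gM k1' k2'.
have tu x : act t^-1 (act g (act u^-1 (act g^-1 x))) =
    act g (act u^-1 (act g^-1 (act t^-1 x))).
  have [w wE wV] : exists2 w : F, w = g * u * g^-1 &
      supported w (act g^-1 @^-1` [set x | act u x <> x]).
    exists (u ^ g^-1); first by rewrite conjgE invgK mulgA.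
    exact: supportedJ.
  have e : t * w = w * t.
    apply: act_faithful => // y; rewrite !act_mul.
    apply: (@commute_off t w set0) => // z tz /wV /= /tgu.
    by rewrite actKV => /tz.
  have : t^-1 * w^-1 = w^-1 * t^-1 by rewrite -!invgM e.
  by move=> /(congr1 (fun f : F => act f x)); rewrite wE !(invgM, invgK, act_mul).
suff e : t * u * t^-1 * u^-1 * (k * h) = h * k.
  by rewrite -e !mulgA !mulgK.
have fixM x : ~ M x -> act (t * u * t^-1 * u^-1) x = x.
  move=> nM; apply: supported_fix nM.
  have tV := supportedV tM; have uV := supportedV uM.
  exact: supportedM (supportedM (supportedM tM uM) tV) uV.
apply: act_faithful => // x; rewrite (act_mul _ (k * h)) (act_mul k h) (act_mul h k).
case: (pselect (M x)) => [Mx|nMx].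
  have ku y : M y -> act k y = act u y by move=> My; rewrite k1// act_mul actK.
  have ht y : M y -> act h y = act t y by move=> My; rewrite h1// invg1 act1.
  rewrite (ku x Mx) (ht x Mx) (ku _ (st _ _ tM Mx)) (ht _ (st _ _ uM Mx)).
  by rewrite !act_mul !actK.
case: (pselect (M (act s x))) => [Mx|nMs].
  rewrite -(actK s x); move: (act s x) Mx => {nMx}{}x Mx.
  have ku y : M y -> act k (act s^-1 y) = act s^-1 (act g (act u^-1 (act g^-1 y))).
    by move=> My; rewrite k2// invgM act_mul.
  have ht y : M y -> act h (act s^-1 y) = act s^-1 (act t^-1 y).
    by move=> My; rewrite h2// act1.
  rewrite (ku x Mx) (ht x Mx) (ku _ (stV _ _ tM Mx)) ht; last first.
    exact: st gM (stV _ _ uM (stV _ _ gM Mx)).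
  rewrite tu fixM// => /Ms; rewrite actKV; apply.
  exact: st gM (stV _ _ uM (stV _ _ gM (stV _ _ tM Mx))).
have nS : ~ S x by case.
rewrite (commute_off Sh Sk _ nS); last first.
  move=> y hy ky; apply: contrapT => nSy; apply/hy/h3 => [My|Msy|O1y].
  - by apply: nSy; left.
  - by apply: nSy; right.
  apply/ky/k3 => [My|Msy|O2y].
  - by apply: nSy; left.
  - by apply: nSy; right.
  by suff : (O1 `&` O2) y by rewrite O12.
apply: fixM => Mkh; apply: nS; apply/Sh/Sk; by left.
Qed.

Definition moves_in (g : full_group G) W : Prop := exists2 x, W x & act g x <> x.

Lemma moves_in_open g W (E : seq X) : open W -> moves_in g W ->
  exists x, [/\ W x, act g x <> x & x \notin E].
Proof.
move=> oW [x Wx gx].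
have [||y [[Wy gy] yE]] := @avoid_finite X T2 (W `&` [set x | act g x <> x]) E pX.
- by apply: openI => //; exact: open_moved.
- by exists x.
by exists y.
Qed.

Lemma moved_points (R : seq F) W (E : seq X) : open W ->
  {in R, forall r, moves_in r W} -> exists L : seq X,
    [/\ {in L, forall x, W x}, {in L, forall x, x \notin E} &
        {in R, forall r, exists2 x, x \in L & act r x <> x}].
Proof.
move=> oW; elim: R => [_|r R IH RW]; first by exists [::].
have [r' r'R|L [LW LE LR]] := IH.
  by apply: RW; rewrite in_cons r'R orbT.
have [|x [Wx rx xE]] := @moves_in_open r W E oW.
  by apply: RW; rewrite mem_head.
exists (x :: L); split.
- by move=> y; rewrite in_cons => /orP[/eqP->|/LW].
- by move=> y; rewrite in_cons => /orP[/eqP->|/LE].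
- move=> r'; rewrite in_cons => /orP[/eqP->|/LR[y yL ry]].
    by exists x => //; rewrite mem_head.
  by exists y => //; rewrite in_cons yL orbT.
Qed.

(** The conditions of the forcing argument are open sets meeting the support of
    each remaining element.  Three of them, M for the action and Z, Z' for the
    corrections, are taken around finite sets of points, each of which
    together with its image under s^-1 is disjoint from the others. *)
Proposition contains_local_tricycles (H : subgroup F) (P : seq F) :
  {in P, forall r, r <> 1} ->
  (forall a, sg_set A a -> exists2 r, r \in P & sg_set H (r ^ a)) ->
  exists M, [/\ open M, M !=set0 &
    forall v U, tricycle v U -> supported v M -> sg_set H v].
Proof.
move=> P1 PH.
pose Good (R : seq F) W := open W /\ {in R, forall r, moves_in r W}.
have [|||||s [R [W [[oW RW] key]]]] :=
  @forcing F (set X) (fun U V => U `<=` V) (@rigid X G) Good H P setT.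
- exact: rigid1.
- exact: rigidM.
- exact: rigidS.
- split; first exact: openT.
  by move=> r rP; have [x rx] := nontrivial_moves effG (P1 r rP); exists x.
- by move=> b [Ab _]; exact: PH.
have sW : moves_in s W by apply: RW; rewrite mem_head.
have {}RW : {in R, forall r, moves_in r W}.
  by move=> r rR; apply: RW; rewrite in_cons rR orbT.
have [L1 [L1W _ L1R]] := moved_points [::] oW RW.
have [L2 [L2W L2E L2R]] := moved_points
  (L1 ++ [seq act s x | x <- L1] ++ [seq act s^-1 x | x <- L1]) oW RW.
pose L := L1 ++ L2.
have [m [Wm sm mE]] := moves_in_open
  (L ++ [seq act s x | x <- L] ++ [seq act s^-1 x | x <- L]) oW sW.
(* Points are chosen so that the sets hat L1, hat L2 and hat [:: m] are disjoint. *)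
pose hat (K : seq X) := K ++ [seq act s^-1 x | x <- K].
have hatd (K K' : seq X) : {in K', forall x,
    x \notin K ++ [seq act s x | x <- K] ++ [seq act s^-1 x | x <- K]} ->
    forall x, x \in hat K' -> x \notin hat K.
  move=> d x; rewrite !mem_cat => /orP[/d|/mapP[y /d + ->]].
    by rewrite !mem_cat !negb_or => /and3P[-> _ ->].
  rewrite !mem_cat !negb_or => /and3P[n1 n2 n3]; apply/andP; split.
    apply/negP => yK; move/negP: n2; apply; apply/mapP.
    by exists (act s^-1 y) => //; rewrite actKV.
  by apply/negP => /mapP[z zK /act_inj e]; rewrite e zK in n1.
have [U1 [V1 [oU1 oV1 mU LV UV1]]] : exists U V : set X, [/\ open U, open V,
    {in hat [:: m], forall x, U x}, {in hat L, forall x, V x} & U `&` V = set0].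
  by apply: sep_seqs => //; apply: hatd => x; rewrite inE => /eqP ->.
have [U2 [V2 [oU2 oV2 L2U L1V UV2]]] : exists U V : set X, [/\ open U, open V,
    {in hat L2, forall x, U x}, {in hat L1, forall x, V x} & U `&` V = set0].
  by apply: sep_seqs => //; apply: hatd.
have hatL K x : {subset K <= L} -> x \in hat K -> V1 x.
  move=> KL; rewrite /hat mem_cat => /orP[xK|/mapP[y yK ->]]; apply: LV.
    by rewrite /hat mem_cat (KL _ xK).
  by rewrite /hat mem_cat map_f ?orbT//; exact: KL.
pose sh O : set X := W `&` (O `&` act s^-1 @^-1` O).
have osh O : open O -> open (sh O).
  by move=> oO; apply: openI => //; apply: openI => //; exact: open_preim.
have shO O x : sh O x -> O x /\ O (act s^-1 x) by move=> [_ []].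
have inhat (K : seq X) O x : {in hat K, forall y, O y} -> {in K, forall y, W y} ->
    x \in K -> sh O x.
  move=> KO KW xK; split; first exact: KW.
  by split; apply: KO; rewrite !mem_cat ?xK// map_f ?orbT.
have [A1 [A2 [oA1 oA2 A1m A2m A12]]] := sep_points T2 sm.
pose M := sh U1 `&` (act s @^-1` A1 `&` A2).
pose Z := sh (V1 `&` V2); pose Z' := sh (V1 `&` U2).
have oM : open M.
  by apply: openI; [exact: osh|apply: openI => //; exact: open_preim].
have oZ : open Z by apply/osh/openI.
have oZ' : open Z' by apply/osh/openI.
have MW : M `<=` W by move=> x [[]].
have ZW : Z `<=` W by move=> x [].
have Z'W : Z' `<=` W by move=> x [].
have Mm : M m.
  split; last by split.
  by apply: (inhat [:: m]) => [//|x|]; rewrite ?mem_head// inE => /eqP ->.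
have Ms x : M x -> ~ M (act s x).
  move=> [_ [sA1 _]] [_ [_ sA2]].
  by suff : (A1 `&` A2) (act s x) by rewrite A12.
exists M; split=> //; first by exists m.
apply: tricycles_of_commutators => // t u g tM uM gM tgu.
(* A point w of Z moved by r and fixed by b is still moved by r ^ b. *)
have good b Y (K : seq X) : open Y -> supported b M ->
    (forall x, Y x -> ~ M x) -> {in K, forall x, Y x} ->
    {in R, forall r, exists2 x, x \in K & act r x <> x} ->
    Good [seq r ^ b | r <- R] Y.
  move=> oY bM YM KY KR; split=> // _ /mapP[r rR ->].
  have [x xK rx] := KR r rR; have Yx := KY x xK; exists x => //.
  by apply/moved_conj; rewrite (supported_fix bM (YM x Yx)).
have U1V1 x : U1 x -> V1 x -> False.
  by move=> a b; suff : (U1 `&` V1) x by rewrite UV1.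
have ZM x : Z x -> ~ M x.
  move=> Zx [Mx _]; have [[V1x _] _] := shO _ _ Zx; have [U1x _] := shO _ _ Mx.
  exact: U1V1 V1x.
have Z'M x : Z' x -> ~ M x.
  move=> Zx [Mx _]; have [[V1x _] _] := shO _ _ Zx; have [U1x _] := shO _ _ Mx.
  exact: U1V1 V1x.
have L1L : {subset L1 <= L} by move=> x; rewrite mem_cat => ->.
have L2L : {subset L2 <= L} by move=> x; rewrite mem_cat orbC => ->.
have goodZ b : supported b M -> Good [seq r ^ b | r <- R] Z.
  move=> bM; apply: (good b Z L1) => // x; apply: inhat => // y yL.
  by split; [exact: hatL yL|exact: L1V].
have goodZ' b : supported b M -> Good [seq r ^ b | r <- R] Z'.
  move=> bM; apply: (good b Z' L2) => // x; apply: inhat => // y yL.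
  by split; [exact: hatL yL|exact: L2U].
have MWr b : rigid M b -> rigid W b by exact: rigidS.
have [c0 [_ c0Z] H0] := key 1 Z (rigid1 G W) ZW (goodZ _ (supported1 M)).
have [c1 [_ c1Z] H1] := key t Z (MWr _ tM) ZW (goodZ _ tM.2).
have [c2 [_ c2Z] H2] := key g Z' (MWr _ gM) Z'W (goodZ' _ gM.2).
have guM := rigidM gM uM.
have [c3 [_ c3Z] H3] := key (g * u) Z' (MWr _ guM) Z'W (goodZ' _ guM.2).
have [OO1 OO2 O12] : [/\ U1 `&` (V1 `&` V2) = set0, U1 `&` (V1 `&` U2) = set0 &
    (V1 `&` V2) `&` (V1 `&` U2) = set0].
  split; first by rewrite setIA UV1 set0I.
    by rewrite setIA UV1 set0I.
  by rewrite setIACA [V2 `&` U2]setIC UV2 setI0.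
have MO x : M x -> U1 x /\ U1 (act s^-1 x) by move=> [Mx _]; exact: shO.
have ZO x : Z x -> (V1 `&` V2) x /\ (V1 `&` V2) (act s^-1 x) by exact: shO.
have Z'O x : Z' x -> (V1 `&` U2) x /\ (V1 `&` U2) (act s^-1 x) by exact: shO.
rewrite (commutator_of_quotients tM.2 uM.2 gM.2 c0Z c1Z c2Z c3Z MO ZO Z'O
  OO1 OO2 O12 Ms tgu).
have Hh := sgM (sgV H0) H1; have Hk := sgM (sgV H2) H3.
exact: sgM (sgM (sgM Hh Hk) (sgV Hh)) (sgV Hk).
Qed.

End Localisation.

(** * The open set on which a confined subgroup is everything *)

Section Linking.
Variables (X : topologicalType) (G : etale_groupoid X).
Local Notation F := (full_group G).
Local Notation A := (alternating_full_group G).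
Hypothesis effG : effective G.
Hypothesis bX : compact_open_basis X.
Hypothesis minG : minimal G.
Hypothesis pX : no_isolated_point X.
Let T2 : hausdorff_space X := base_hausdorff G.
Implicit Types (g h k t s u v b c j r a : full_group G) (x y z : X).
Implicit Types (U V W Y M O : set X) (E : seq X).
Local Open Scope group_scope.

Definition off E : set X := [set x | x \notin E].

Lemma off_open E : open (off E). Proof. exact: open_notin. Qed.

Lemma off_fix g E x : supported g (off E) -> x \in E -> act g x = x.
Proof. by move=> sg xE; apply: (supported_fix sg); rewrite /off /= xE. Qed.

Lemma off_catl E E' : off (E ++ E') `<=` off E.
Proof. by move=> x; rewrite /off /mkset mem_cat negb_or => /andP[]. Qed.

Lemma off_catr E E' : off (E ++ E') `<=` off E'.
Proof. by move=> x; rewrite /off /mkset mem_cat negb_or => /andP[]. Qed.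

Lemma tricycle_in x g2 g3 W N : open W -> W x -> W (act g2 x) -> W (act g3 x) ->
  act g2 x <> x -> act g3 x <> x -> act g2 x <> act g3 x -> nbhs x N ->
  exists V t, [/\ open V, V x, V `<=` N, rotates t V g2 g3 & supported t W].
Proof.
move=> oW W1 W2 W3 d2 d3 d23 nN.
have nW g : W (act g x) -> nbhs x (act g @^-1` W).
  by move=> Wg; apply: act_continuous; exact: open_nbhs_nbhs.
have nN' : nbhs x (N `&` (W `&` (act g2 @^-1` W `&` act g3 @^-1` W))).
  apply: filterI => //; apply: filterI; first exact: open_nbhs_nbhs.
  by apply: filterI; exact: nW.
have [V [t [oV Vx VN rt]]] := tricycle_at effG bX d2 d3 d23 nN'.
exists V, t; split=> //; first by move=> y /VN[].
by apply: (rotates_supported rt) => y /VN[_ [? [? ?]]].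
Qed.

(** Rotate x to its target and on to a third point found in W. *)
Lemma transporter x g W : open W -> W x -> W (act g x) ->
  exists t V, [/\ tricycle t V, supported t W & act t x = act g x].
Proof.
move=> oW Wx Wg; have [e|/eqP ne] := eqVneq (act g x) x.
  exists 1, set0; split; [exact: tricycle1|exact: supported1|].
  by rewrite act1 e.
have [|k [Wk]] := mover effG bX minG pX x [:: x; act g x] oW; first by exists x.
rewrite !inE negb_or => /andP[/eqP kx /eqP kg].
have [V [t [oV Vx _ rt st]]] := tricycle_in oW Wx Wg Wk ne kx (nesym kg) filterT.
have [tt t1 _] := rt.
by exists t, V; split=> //; have [] := t1 x Vx.
Qed.

Definition all_tricycles (H : subgroup F) U : Prop :=
  forall v V, tricycle v V -> supported v U -> sg_set H v.

Variable H : subgroup F.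

Lemma all_tricyclesJ U h : sg_set H h -> all_tricycles H U ->
  all_tricycles H (act h @^-1` U).
Proof.
move=> Hh HU v V tv vU; rewrite -(conjgKV h v); apply: sgJ => //.
apply: HU (tricycleJ h^-1 tv) _.
by apply: supportedS (supportedJ (h := h^-1) vU) => x /=; rewrite actKV.
Qed.

Lemma piece_supported t v U V W : tricycle v U -> piece t v V ->
  (forall y, V y -> [/\ W y, W (act v y) & W (act v (act v y))]) ->
  supported t W.
Proof.
move=> [_ _ v3 _ _] [_ pN] VW x nx.
have : cyc v V x by apply: contrapT => /pN.
by move=> [] /VW[]; rewrite ?v3.
Qed.

(** Points outside U are in U', and a tricycle supported in U' brings them into the
    overlap one after the other, without touching those already in U. *)
Lemma gather U U' (K : seq X) : open U -> open U' -> (U `&` U') !=set0 ->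
  all_tricycles H U' -> {in K, forall z, (U `|` U') z} ->
  exists h, [/\ sg_set H h, supported h U' & {in K, forall z, U (act h z)}].
Proof.
move=> oU oU' UU' HU'; elim: K => [_|z K IH KU].
  by exists 1; split=> //; [exact: sg1|exact: supported1].
have [y yK|h [Hh hU' hK]] := IH; first by apply: KU; rewrite in_cons yK orbT.
have : (U `|` U') (act h z).
  have [Uz|U'z] : (U `|` U') z by apply: KU; rewrite mem_head.
    case: (pselect (act h z = z)) => [->|ne]; first by left.
    by right; apply: (supported_stable hU'); exact: hU'.
  by right; exact: supported_stable.
case: (pselect (U (act h z))) => [Uhz _|nU [//|U'hz]].
  exists h; split=> // y; rewrite in_cons => /orP[/eqP-> //|]; exact: hK.
pose E := [seq act h y | y <- K].
have [|g [[Ug U'g] gE]] := mover effG bX minG pX (act h z) E _ UU'.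
  exact: openI.
have [|||t [V [tt tW tz]]] := @transporter (act h z) g (U' `&` off E).
- by apply: openI => //; exact: off_open.
- split=> //; apply/negP => /mapP[y yK e].
  by apply: nU; rewrite e; exact: hK.
- by [].
have tU' : supported t U' by apply: supportedS tW => y [].
exists (t * h); split; [apply: sgM => //; exact: HU' tt _|exact: supportedM|].
move=> y; rewrite in_cons act_mul => /orP[/eqP->|yK]; first by rewrite tz.
rewrite (supported_fix tW); first exact: hK.
by move=> [_ /negP]; apply; exact: map_f.
Qed.

(** An element of H that gathers the orbit of x into U conjugates a small
    three-cycle around x to one supported in U. *)
Lemma all_tricyclesU U U' : open U -> open U' -> (U `&` U') !=set0 ->
  all_tricycles H U -> all_tricycles H U' -> all_tricycles H (U `|` U').
Proof.
move=> oU oU' UU' HU HU' v V tv vUU; apply: (tricycle_local effG bX tv) => x Vx.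
have [_ _ v3 _ _] := tv.
have xU : (U `|` U') x by apply/vUU/(tricycle_moves tv); constructor 1.
have st y : (U `|` U') y -> (U `|` U') (act v y) by exact: supported_stable.
have [z|h [Hh _ hK]] := @gather U U' [:: x; act v x; act v (act v x)] oU oU' UU' HU'.
  by rewrite !inE => /or3P[]/eqP->; do ?exact: xU; [exact: st|exact/st/st].
have nU g : U (act g x) -> nbhs x (act g @^-1` U).
  by move=> Ug; apply: act_continuous; exact: open_nbhs_nbhs.
exists (act h @^-1` U `&` (act (h * v) @^-1` U `&` act (h * (v * v)) @^-1` U)).
  apply: filterI; last apply: filterI; apply: nU; rewrite ?act_mul; apply: hK;
    by rewrite !inE eqxx ?orbT.
move=> W t oW cW WN WV pt; have tt := piece_tricycle tv oW cW WV pt.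
apply: (all_tricyclesJ Hh HU tt).
apply: (piece_supported tv pt) => y /WN [/= h1 [h2 h3]].
by rewrite !act_mul in h2 h3.
Qed.

Definition linked x y : Prop :=
  exists U, [/\ open U, U x, U y & all_tricycles H U].

Lemma linked_sym x y : linked x y -> linked y x.
Proof. by move=> [U [oU Ux Uy HU]]; exists U. Qed.

Lemma linked_trans y x z : linked x y -> linked y z -> linked x z.
Proof.
move=> [U [oU Ux Uy HU]] [V [oV Vy Vz HV]]; exists (U `|` V); split.
- exact: openU.
- by left.
- by right.
- by apply: all_tricyclesU => //; exists y.
Qed.

Lemma linked_act h x y : sg_set H h -> linked x y -> linked (act h x) (act h y).
Proof.
move=> Hh [U [oU Ux Uy HU]]; exists (act h^-1 @^-1` U); split.
- exact: open_preim.
- by rewrite /= actK.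
- by rewrite /= actK.
- by apply: all_tricyclesJ => //; exact: sgV.
Qed.

(** Its complement is the finite set Q of the theorem. *)
Definition free_part : set X := [set x | linked x x].

Lemma free_part_open : open free_part.
Proof.
rewrite openE => x [U [oU Ux _ HU]]; apply: filterS (open_nbhs_nbhs (conj oU Ux)).
by move=> y Uy; exists U.
Qed.

Lemma free_part_act h x : sg_set H h -> free_part (act h x) <-> free_part x.
Proof.
move=> Hh; split=> [/(linked_act (sgV Hh))|]; last exact: linked_act.
by rewrite /free_part /= actK.
Qed.

Lemma free_part_tricycles :
  (forall x y, free_part x -> free_part y -> linked x y) ->
  all_tricycles H free_part.
Proof.
move=> con v V tv vO; apply: (tricycle_local effG bX tv) => x Vx.
have Ox : free_part x by apply/vO/(tricycle_moves tv); constructor 1.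
have st y : free_part y -> free_part (act v y) by exact: supported_stable.
have [U1 [oU1 U1x U1y HU1]] := con _ _ Ox (st _ Ox).
have [U2 [oU2 U2x U2y HU2]] := con _ _ Ox (st _ (st _ Ox)).
pose U := U1 `|` U2.
have oU : open U by exact: openU.
have HU : all_tricycles H U by apply: all_tricyclesU => //; exists x.
have nU g : U (act g x) -> nbhs x (act g @^-1` U).
  by move=> Ug; apply: act_continuous; exact: open_nbhs_nbhs.
exists (U `&` (act v @^-1` U `&` act (v * v) @^-1` U)).
  apply: filterI; first by apply: open_nbhs_nbhs; split=> //; left.
  by apply: filterI; apply: nU; rewrite ?act_mul; [left|right].
move=> W t oW cW WN WV pt.
apply: HU (piece_tricycle tv oW cW WV pt) _.
by apply: (piece_supported tv pt) => y /WN [/= h1 [h2]]; rewrite act_mul.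
Qed.

(** First move q to a point x with s x different from x, then move some point o of
    O to s x. *)
Lemma escape q O s E : open O -> O !=set0 -> s <> 1 -> q \notin E ->
  exists b o, [/\ rigid (off E) b, O o, o \notin q :: E & act (s ^ b) q = o].
Proof.
move=> oO O0 s1 qE.
have [g1 [sg g1E]] := mover effG bX minG pX q
  ((q :: E) ++ [seq act s^-1 y | y <- q :: E]) (open_moved s)
  (nontrivial_moves effG s1).
set x := act g1 q in sg g1E.
move: g1E; rewrite mem_cat negb_or => /andP[xE sxE].
have {sxE} sxE : act s x \notin q :: E.
  by apply: contra sxE => sxE; apply/mapP; exists (act s x); rewrite ?actK.
have offE y : y \notin q :: E -> off E y.
  by rewrite in_cons negb_or => /andP[].
have [t1 [V1 [tt1 st1 t1q]]] := transporter (off_open E) qE (offE _ xE).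
have [g2 [Oo oE]] := mover effG bX minG pX (act s x) (q :: E) oO O0.
set o := act g2 (act s x) in Oo oE.
have st E' t y : supported t (off E') -> off E' y -> off E' (act t y).
  exact: supported_stable.
have t1o : off (x :: E) (act t1 o).
  rewrite /off /= in_cons negb_or; apply/andP; split; last exact: st st1 (offE _ oE).
  apply/eqP; rewrite /x -t1q => /act_inj oq.
  by rewrite oq mem_head in oE.
have sx : off (x :: E) (act s x).
  by rewrite /off /= in_cons negb_or (offE _ sxE) andbT; exact/eqP.
have e2 : act (t1 * g2)^-1 (act t1 o) = act s x.
  by rewrite invgM act_mul actK /o actK.
have [t2 [V2 [tt2 st2 t2o]]] := @transporter (act t1 o) (t1 * g2)^-1 (off (x :: E))
  (off_open _) t1o (eq_ind_r _ sx e2).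
rewrite e2 in t2o; exists (t2 * t1), o; split=> //.
  apply: rigidM; last exact: tricycle_rigid tt1 st1.
  apply: tricycle_rigid tt2 _ => //; apply: supportedS st2 => y.
  by rewrite /off /= in_cons negb_or => /andP[].
rewrite conjgE !act_mul t1q (off_fix st2) ?mem_head//.
by rewrite -t2o -(act_mul t2 t1) actK.
Qed.

Variable P : seq F.
Hypothesis P1 : {in P, forall r, r <> 1}.
Hypothesis PH : forall a, sg_set A a -> exists2 r, r \in P & sg_set H (r ^ a).

(** The forcing lemma with complements of finite sets as conditions: each s ^ b
    is in H up to conjugation by an element fixing a prescribed finite set. *)
Lemma forcing_off : exists s E, s <> 1 /\ forall b E', rigid (off E) b ->
  exists2 c, rigid (off (E' ++ E)) c & sg_set H (s ^ (b * c)).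
Proof.
pose Good (R : seq F) W := (exists E, off E `<=` W) /\ {in R, forall r, r <> 1}.
have [|||||s [R [W [[[E EW] R1] key]]]] :=
  @forcing F (set X) (fun U V => U `<=` V) (@rigid X G) Good H P setT.
- exact: rigid1.
- exact: rigidM.
- exact: rigidS.
- by split=> //; exists [::].
- by move=> b [Ab _]; exact: PH.
exists s, E; split; first by apply: R1; rewrite mem_head.
move=> b E' bE; apply: key.
- exact: rigidS EW _ bE.
- exact: (subset_trans (@off_catr E' E) EW).
split; first by exists (E' ++ E).
move=> _ /mapP[r rR ->] e; apply: (R1 r); first by rewrite in_cons rR orbT.
by rewrite -(conjgK b r) e conj1g.
Qed.

Lemma conj_fixed k c x y : supported c (off [:: x; y]) -> act k x = y ->
  act (k ^ c) x = y.
Proof.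
move=> sc kxy; rewrite conjgE !act_mul (off_fix sc) ?mem_head// kxy.
by rewrite (off_fix (supportedV sc))// !inE eqxx orbT.
Qed.

(** Otherwise some point q outside O is still unconstrained, and s can be made to
    send it into O by an element of H, which preserves the complement of O. *)
Lemma invariant_cofinite O : open O -> O !=set0 ->
  (forall h x, sg_set H h -> O (act h x) -> O x) ->
  exists L : seq X, forall x, ~ O x -> x \in L.
Proof.
move=> oO O0 HO; apply: contrapT => nL.
have inf (L : seq X) : exists2 x, x \notin L & ~ O x.
  apply: contrapT => nx; apply: nL; exists L => x nO.
  by apply: contrapT => /negP xL; apply: nx; exists x.
have [s [E [s1 key]]] := forcing_off.
have [q qE nOq] := inf E.
have [b [o [bE Oo _ sq]]] := escape oO O0 s1 qE.
have [c [_ cE] Hc] := key b [:: q; o] bE.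
apply: nOq; apply: (HO _ q Hc); rewrite conjgM (conj_fixed _ sq)//.
exact: supportedS (@off_catl [:: q; o] E) cE.
Qed.

(** With two classes C and D, use two points of C, both unconstrained, and make a
    conjugate of s send the first into C and the second into D.  Linked points
    would have images that are not linked. *)
Lemma free_part_linked x y : free_part x -> free_part y -> linked x y.
Proof.
move=> Ox Oy; apply: contrapT => nxy.
pose C := [set z | linked x z]; pose D := [set z | free_part z /\ ~ linked x z].
have oC : open C.
  rewrite openE => z [U [oU Ux Uz HU]].
  apply: filterS (open_nbhs_nbhs (conj oU Uz)) => w Uw.
  by exists U.
have oD : open D.
  rewrite openE => z [[U [oU Uz _ HU]] nz].
  apply: filterS (open_nbhs_nbhs (conj oU Uz)) => w Uw; split; first by exists U.
  by move=> xw; apply: nz; apply: linked_trans xw _; exists U.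
have [s [E [s1 key]]] := forcing_off.
have C0 : C !=set0 by exists x.
have D0 : D !=set0 by exists y.
(* o1 stays in C while o2 leaves it; b2 and c do not disturb the first pair. *)
have [p1 [Cp1 p1E]] := avoid_finite T2 E pX oC C0.
have [b1 [o1 [b1E Co1 o1E sp1]]] := escape oC C0 s1 p1E.
have [p2 [Cp2 p2E]] := avoid_finite T2 ([:: p1; o1] ++ E) pX oC C0.
have sb1 : s ^ b1 <> 1.
  by move=> e; apply: s1; rewrite -(conjgK b1 s) e conj1g.
have [b2 [o2 [b2E Do2 _ sp2]]] := escape oD D0 sb1 p2E.
have sub1 L := @off_catr L E; have sub2 L := @off_catl L E.
have [c [_ cE] Hc] := key (b1 * b2) [:: p1; o1; p2; o2]
  (rigidM b1E (rigidS (sub1 _) b2E)).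
set h := s ^ _ in Hc.
have h1 : act h p1 = o1.
  rewrite /h -mulgA conjgM; apply: conj_fixed sp1.
  apply: supportedM; first by apply: supportedS b2E.2; exact: sub2.
  apply: supportedS cE => z /sub2; rewrite /off /= !inE !negb_or.
  by move=> /and4P[-> ->].
have h2 : act h p2 = o2.
  rewrite /h conjgM conjgM; apply: conj_fixed sp2.
  apply: supportedS cE => z /sub2; rewrite /off /= !inE !negb_or.
  by move=> /and4P[_ _ -> ->].
have [_] := Do2; apply; apply: (linked_trans Co1).
by rewrite -h1 -h2; apply: linked_act => //; apply: linked_trans Cp2; exact: linked_sym.
Qed.

Proposition free_part_spec : [/\ all_tricycles H free_part,
  forall h x, sg_set H h -> free_part (act h x) <-> free_part x &
  exists L : seq X, forall x, ~ free_part x -> x \in L].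
Proof.
split.
- exact: free_part_tricycles free_part_linked.
- exact: free_part_act.
apply: invariant_cofinite; first exact: free_part_open.
- have [M [oM [x Mx] HM]] := contains_local_tricycles effG bX minG pX P1 PH.
  by exists x; exists M.
- by move=> h x /free_part_act ->.
Qed.

End Linking.

(** * Elements of the alternating full group fixing a neighbourhood of a finite set *)

Section Fixators.
Variables (X : topologicalType) (G : etale_groupoid X).
Local Notation F := (full_group G).
Local Notation A := (alternating_full_group G).
Hypothesis effG : effective G.
Hypothesis bX : compact_open_basis X.
Hypothesis minG : minimal G.
Hypothesis pX : no_isolated_point X.
Let T2 : hausdorff_space X := base_hausdorff G.
Implicit Types (g h k t s u v b c j r : full_group G) (x y z p : X).
Implicit Types (U V W Y M O : set X) (E : seq X).
Local Open Scope group_scope.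

Lemma tricycleV g U : tricycle g U -> tricycle g^-1 U.
Proof.
move=> tg; have [oU cU g3 gU sU] := tg.
have gV x : act g^-1 x = act g (act g x) by exact: act_tricycleV tg.
split=> //.
- by move=> x; rewrite !gV !g3.
- by move=> x Ux; rewrite gV; exact: tricycle_notin2 tg Ux.
- move=> x nx; have : cyc g U x by apply: (supportedV (Y := cyc g U)) nx.
  by rewrite /cyc /= !gV g3 => -[]; [constructor 1|constructor 3|constructor 2].
Qed.

Lemma tricycle_base g U x : tricycle g U -> act g x <> x ->
  exists2 V, tricycle g V & V x.
Proof.
move=> tg gx; have gg : g ^ g = g by rewrite conjgE mulKg.
have [_ _ _ _ /(_ x gx)[]] := tg; first by exists U.
  by move=> Ugx; exists (act g @^-1` U) => //; rewrite -{1}gg; exact: tricycleJ.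
move=> Uggx; exists (act g @^-1` (act g @^-1` U)) => //.
by rewrite -{1}gg; apply: tricycleJ; rewrite -{1}gg; exact: tricycleJ.
Qed.

(** Near x the three-cycles c on V, c V, c^2 V and t on V, c V, g V agree, so
    t^-1 c fixes x; in fact it is the three-cycle c V -> c^2 V -> g V -> c V, times
    the part of c away from the orbit of V. *)
Lemma replace_third_vertex c U Y x g : tricycle c U -> supported c Y ->
  act c x <> x -> open Y -> Y (act g x) ->
  act g x \notin [:: x; act c x; act c (act c x)] ->
  exists2 N, nbhs x N & forall V t, V x -> V `<=` N -> rotates t V c g ->
    sg_set (alt_on G (Y `\ x)) (t^-1 * c).
Proof.
move=> tc0 cY cx oY Yg; rewrite !inE !negb_or => /and3P[/eqP g0 /eqP g1 /eqP g2].
have {U tc0} [U tc Ux] := tricycle_base tc0 cx.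
have [oU cU c3 cU1 sU] := tc; have clU := compact_closed T2 cU.
pose w := c * c; have wE y : act w y = act c (act c y) by exact: act_mul.
have [N nN NP] := separating_nbhs [:: 1; c; w; g] x.
have nY : nbhs x (act g @^-1` Y).
  by apply: act_continuous; exact: open_nbhs_nbhs.
exists (N `&` (U `&` act g @^-1` Y)).
  by apply: filterI => //; apply: filterI => //; exact: open_nbhs_nbhs.
move=> V t Vx VN rt; have [tt t1 ft] := rt; have [oV cV _ _ _] := tt.
have VU : V `<=` U by move=> y /VN[_ []].
have sep h k : h \in [:: 1; c; w; g] -> k \in [:: 1; c; w; g] ->
    act h x <> act k x -> forall y z, V y -> V z -> act h y <> act k z.
  by move=> hi ki ne y z /VN[Ny _] /VN[Nz _]; exact: NP.
have [i1 ic iw ig] : [/\ 1 \in [:: 1; c; w; g], c \in [:: 1; c; w; g],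
    w \in [:: 1; c; w; g] & g \in [:: 1; c; w; g]].
  by rewrite !inE !eqxx !orbT.
have cn2 : act w x <> x.
  by rewrite wE => e; apply: (tricycle_notin2 tc Ux); rewrite e.
have cn21 : act w x <> act c x by rewrite wE => /act_inj.
have d1 h : h \in [:: c; w; g] -> forall y z, V y -> V z -> y <> act h z.
  move=> hi y z Vy Vz e; apply: (sep 1 h i1 _ _ y z Vy Vz); rewrite ?act1//.
    by rewrite in_cons hi orbT.
  by move: hi; rewrite !inE => /or3P[]/eqP->; exact/nesym.
have jc : c \in [:: c; w; g] by rewrite !inE eqxx.
have jw : w \in [:: c; w; g] by rewrite !inE eqxx orbT.
have jg : g \in [:: c; w; g] by rewrite !inE eqxx !orbT.
have dcw := sep c w ic iw (nesym cn21).
have dcg := sep c g ic ig (nesym g1).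
have dwg : forall y z, V y -> V z -> act w y <> act g z.
  by apply: sep => //; rewrite wE; exact/nesym.
(* The three-cycle c V -> c^2 V -> g V -> c V, written from its first vertex. *)
pose W := act c^-1 @^-1` V.
have WV y : V y -> W (act c y) by move=> Vy; rewrite /W /= actK.
have [t' rt'] : exists t', rotates t' W c (g * c^-1).
  apply: make_tricycle => //.
  - exact: open_preim.
  - by rewrite /W act_preimage; exact: compact_act.
  - move=> y Wy; rewrite /W /= actK => Vy; apply: (d1 c jc _ _ Vy Wy).
    by rewrite actKV.
  - move=> y Wy Wgy; apply: (dcg _ _ Wgy Wy).
    by rewrite act_mul actKV.
  - move=> y z Wy Wz; have := dwg _ _ Wy Wz.
    by rewrite wE actKV act_mul.
have [tt' t1' ft'] := rt'.
have r1 a : V a -> act t' (act c a) = act w a.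
  by move=> Va; rewrite wE; have [] := t1' _ (WV _ Va).
have r2 a : V a -> act t' (act w a) = act g a.
  by move=> Va; rewrite wE; have [_ + _] := t1' _ (WV _ Va); rewrite act_mul actK.
have r3 a : V a -> act t' (act g a) = act c a.
  by move=> Va; have [_ _] := t1' _ (WV _ Va); rewrite act_mul actK.
have f' y : (forall a, V a -> [/\ y <> act c a, y <> act w a & y <> act g a]) ->
    act t' y = y.
  move=> ny; apply: (rotates_fix rt') => z Wz; have [n1 n2 n3] := ny _ Wz.
  by rewrite actKV in n1; rewrite wE actKV in n2; rewrite act_mul.
have f1 a : V a -> act t' a = a.
  by move=> Va; apply: f' => z Vz; split; exact: d1.
have [c0 pc0] := piece_exists effG tc oV cV VU.
have o2 : open (U `&` ~` V).
  by apply: openI => //; apply: closed_openC; exact: compact_closed.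
have c2 : compact (U `&` ~` V) by apply: compact_closedI => //; exact: open_closedC.
have U2 : U `&` ~` V `<=` U by move=> y [].
have [c' pc'] := piece_exists effG tc o2 c2 U2.
have ce : c = c0 * c'.
  apply: (piece_setU effG tc VU U2 _ pc0 pc').
    by rewrite setICA setICr setI0.
  have -> : V `|` (U `&` ~` V) = U by rewrite setUIr setUv setIT setUidr.
  by split=> y //; exact: supported_fix.
have [pC pN] := pc0.
have q1 a : V a -> act c0 a = act c a by move=> Va; apply: pC; constructor 1.
have q2 a : V a -> act c0 (act c a) = act w a.
  by move=> Va; rewrite wE; apply: pC; constructor 3; rewrite c3.
have q3 a : V a -> act c0 (act w a) = a.
  by move=> Va; rewrite wE pC ?c3//; constructor 2; rewrite c3.
have qN y : (forall a, V a -> [/\ y <> a, y <> act c a & y <> act w a]) ->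
    act c0 y = y.
  move=> ny; apply: pN => -[] Va; have [n1 n2 n3] := ny _ Va; first exact: n1.
    by apply: n3; rewrite wE c3.
  by apply: n2; rewrite c3.
have e0 : c0 = t * t'.
  apply: act_faithful => // y; rewrite act_mul.
  case: (pselect (exists2 a, V a & [\/ y = a, y = act c a, y = act w a |
      y = act g a])) => [[a Va]|ny].
    have [a1 a2 a3] := t1 a Va.
    have tw : act t (act w a) = act w a.
      apply: (rotates_fix rt) => z Vz; split.
      - by apply/nesym; exact: d1.
      - by apply/nesym; exact: dcw.
      - exact: dwg.
    move=> [->|->|->|->].
    - by rewrite f1// a1 q1.
    - by rewrite r1// q2// tw.
    - by rewrite r2// q3// a3.
    - rewrite r3// a2 qN// => z Vz; split; apply/nesym.
      + exact: d1.
      + exact: dcg.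
      + exact: dwg.
  have nyV h : h \in [:: c; w; g] -> forall a, V a -> y <> act h a.
    move=> hi a Va e; apply: ny; exists a => //; move: hi e.
    by rewrite !inE => /or3P[]/eqP->;
      [constructor 2|constructor 3|constructor 4].
  have nyV0 a : V a -> y <> a.
    by move=> Va e; apply: ny; exists a => //; constructor 1.
  rewrite f'; last by move=> a Va; split; exact: nyV.
  rewrite qN; last by move=> a Va; split; [exact: nyV0|exact: nyV|exact: nyV].
  by apply/esym/(rotates_fix rt) => a Va; split; [exact: nyV0|exact: nyV|exact: nyV].
rewrite ce e0 !mulgA mulVg mul1g; apply: sgM.
  apply: alt_on_gen tt' _ => y /ft' [z Wz e].
  have YV a : V a -> [/\ Y a, Y (act c a) & [/\ Y (act w a) & Y (act g a)]].
    move=> Va; have Ya : Y a.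
      by apply/cY/(tricycle_moves tc); constructor 1; exact: VU.
    have st y' : Y y' -> Y (act c y') by exact: supported_stable.
    split=> //; [exact: st|split]; first by rewrite wE; exact/st/st.
    by have [_ []] := VN _ Va.
  have [_ Yc [Yw Yg']] := YV _ Wz.
  have zE : z = act c (act c^-1 z) by rewrite actKV.
  case: e => ->.
  - by split; rewrite zE// => e; apply: (d1 c jc x _ Vx Wz).
  - rewrite zE -wE; split=> // e; by apply: (d1 w jw x _ Vx Wz).
  - rewrite act_mul; split=> // e; by apply: (d1 g jg x _ Vx Wz).
apply: alt_on_gen (piece_tricycle tc o2 c2 U2 pc') _ => y ny.
have Cy : cyc c (U `&` ~` V) y by apply: contrapT => /pc'.2.
split; first by apply: cY; rewrite -pc'.1.
move=> yx; rewrite yx in Cy.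
have Cx : cyc c V x by constructor 1.
by have [a Va [_]] := cyc_meet tc VU U2 Cx Cy.
Qed.

Lemma alt_on_fix_near Y g x : sg_set (alt_on G Y) g -> ~ Y x ->
  nbhs x [set y | act g y = y].
Proof.
move=> Yg nY.
have cl : group_closed [in [set g : F | nbhs x [set y | act g y = y]]].
  split=> [|h k]; rewrite ?inE /=.
    by apply: filterS (filterT : nbhs x setT) => y _ /=; exact: act1.
  move=> nh nk; apply: filterS (filterI nh nk) => y [/= hy ky].
  by rewrite act_mul -{1}ky actK.
apply: (Yg (Subgroup cl)) => h [U th hY] /=.
by apply: (tricycle_fix_near th); exact: supported_fix nY.
Qed.

Lemma alt_on_product Y g : sg_set (alt_on G Y) g -> exists2 cs : seq F,
  {in cs, forall c, exists2 U, tricycle c U & supported c Y} &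
  g = \prod_(c <- cs) c.
Proof.
move=> Yg; pose S := [set g : F | exists2 cs : seq F,
  {in cs, forall c, exists2 U, tricycle c U & supported c Y} &
  g = \prod_(c <- cs) c].
have SV h : S h -> S h^-1.
  move=> [cs csP ->]; exists [seq c^-1 | c <- rev cs].
    move=> _ /mapP[c + ->]; rewrite mem_rev => /csP[U tc cY].
    by exists U; [exact: tricycleV|exact: supportedV].
  elim: cs {csP} => [|c cs IH]; first by rewrite !big_nil invg1.
  by rewrite big_cons invgM IH rev_cons map_rcons -cats1 big_cat big_seq1.
have cl : group_closed [in S].
  split=> [|h k]; rewrite ?inE; first by exists [::]; rewrite ?big_nil.
  move=> Sh /SV Sk; have [cs csP ->] := Sh; have [ds dsP ->] := Sk.
  exists (cs ++ ds); last by rewrite big_cat.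
  by move=> c; rewrite mem_cat => /orP[/csP|/dsP].
apply: (Yg (Subgroup cl)) => c cP; exists [:: c]; last by rewrite big_seq1.
by move=> d; rewrite inE => /eqP ->.
Qed.

(** Modulo tricycles avoiding z, the product c k is again a three-cycle moving z.
    If c moves x = k z, replace c by t with the same germ at x but supported away
    from z, which is possible as x and c x differ from z; then t k t^-1 works. *)
Lemma coset_step Y z k c U U' : open Y -> tricycle k U -> supported k Y ->
  act k z <> z -> tricycle c U' -> supported c Y -> act c (act k z) <> z ->
  exists k' V, [/\ tricycle k' V, supported k' Y &
    sg_set (alt_on G (Y `\ z)) (k'^-1 * (c * k))].
Proof.
move=> oY tk kY kz tc cY ckz; set x := act k z in kz ckz.
have Yk y : Y (act k y) -> Y y.
  by move=> Yky; rewrite -(actK k y); apply: supported_stable Yky; exact: supportedV.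
(* If c fixes x = k z then c k = k (c ^ k), and c ^ k avoids z. *)
case: (pselect (act c x = x)) => [cx|cx].
  exists k, U; split=> //; apply: (alt_on_gen (tricycleJ k tc)).
  move=> y /moved_conj ny; split; first by apply/Yk/cY.
  by move=> yz; rewrite yz in ny.
have Yx : Y x by apply: cY.
have [|g [Yg]] := mover effG bX minG pX x [:: x; act c x; act c (act c x); z] oY.
  by exists x.
rewrite !inE !negb_or => /and4P[/eqP g0 /eqP g1 /eqP g2 /eqP g3].
have gni : act g x \notin [:: x; act c x; act c (act c x)].
  by rewrite !inE !negb_or; apply/and3P; split; apply/eqP.
have [N nN NP] := replace_third_vertex tc cY cx oY Yg gni.
have oYz : open (Y `\ z).
  by rewrite setDE; apply: openI => //; rewrite (_ : ~` _ = [set y | y <> z])//;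
    exact: open_neq.
have Ycx : Y (act c x) by exact: supported_stable.
have [V [t [oV Vx VN rt tYz]]] := tricycle_in effG bX oYz
  (conj Yx kz) (conj Ycx ckz) (conj Yg g3) cx g0 (nesym g1) nN.
have Bt := NP V t Vx VN rt; have [tt _ _] := rt.
have tY : supported t Y by apply: supportedS tYz => y [].
exists (k ^ t^-1), (act t^-1 @^-1` U); split; first exact: tricycleJ.
  apply: supportedS (supportedJ (h := t^-1) kY) => y /= Yty.
  by rewrite -(actKV t y); exact: supported_stable Yty.
have -> : (k ^ t^-1)^-1 * (c * k) = t * ((t^-1 * c) ^ k).
  by rewrite !conjgE !(invgM, invgK) !mulgA.
apply: sgM; first exact: alt_on_gen tt tYz.
apply: alt_onS (alt_onJ (h := k) Bt) => y [/= Yky kyx]; split; first exact: Yk.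
by move=> yz; apply: kyx; rewrite yz.
Qed.

(** Write g as a product of three-cycles and transport p to a base point z which
    the trajectory of p never meets.  By [coset_step] the translated product is,
    modulo tricycles avoiding z, a three-cycle with the same germ at z as the
    transporting one; comparing both with a third three-cycle shows that they agree
    modulo such tricycles. *)
Lemma alt_on_point Y p g : open Y -> sg_set (alt_on G Y) g ->
  nbhs p [set y | act g y = y] -> sg_set (alt_on G (Y `\ p)) g.
Proof.
move=> oY Yg ng; case: (pselect (Y p)) => [Yp|nY]; last first.
  by apply: alt_onS Yg => y Yy; split=> // yp; apply: nY; rewrite -yp.
have [cs csP gE] := alt_on_product Yg.
(* The successive images of p under the tails of the product. *)
pose traj := [seq act (\prod_(c <- drop i cs) c) p | i <- iota 0 (size cs).+1].
have [|h [Yz zE]] := mover effG bX minG pX p (p :: traj) oY; first by exists p.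
set z := act h p in Yz zE.
move: zE; rewrite in_cons negb_or => /andP[/eqP zp ztraj].
have Yhz : Y (act h^-1 z) by rewrite actK.
have [s [S [ts sY sz]]] := transporter effG bX minG pX oY Yz Yhz.
rewrite actK in sz.
have [k [K [tk kY Bk]]] : exists k K, [/\ tricycle k K, supported k Y &
    sg_set (alt_on G (Y `\ z)) (k^-1 * (g * s))].
  have {ztraj} ztraj i : (i <= size cs)%N ->
      act (\prod_(c <- drop i cs) c) p <> z.
    move=> ics e; move/negP: ztraj; apply; apply/mapP; exists i; last by rewrite e.
    by rewrite mem_iota.
  rewrite gE {Yg ng gE traj}; elim: cs csP ztraj => [_ _|c cs IH csP ztraj].
    by exists s, S; split=> //; rewrite big_nil mul1g mulVg; exact: sg1.
  have [d dcs|i ics|k [K [tk kY Bk]]] := IH.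
  - by apply: csP; rewrite in_cons dcs orbT.
  - exact: (ztraj i.+1 ics).
  have [U tc cY] : exists2 U, tricycle c U & supported c Y.
    by apply: csP; rewrite mem_head.
  have kz : act k z = act (\prod_(d <- cs) d) p.
    have /(supported_fix (alt_on_supported Bk)) : ~ (Y `\ z) z by move=> [_]; apply.
    by rewrite !act_mul sz => /(congr1 (act k)); rewrite actKV => ->.
  have [||k' [V [tk' kY' Bk']]] := coset_step oY tk kY _ tc cY (z := z).
  - by rewrite kz; have := ztraj 1%N isT; rewrite /= drop0.
  - by rewrite kz -act_mul; have := ztraj 0%N isT; rewrite /= big_cons.
  exists k', V; split=> //.
  have -> : k'^-1 * (\prod_(j <- (c :: cs)) j * s) =
      k'^-1 * (c * k) * (k^-1 * (\prod_(j <- cs) j * s)).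
    by rewrite big_cons !mulgA mulgK.
  exact: sgM.
have nz : nbhs z [set y | act k y = act s y].
  have nzY : ~ (Y `\ z) z by move=> [_]; apply.
  have nb := alt_on_fix_near Bk nzY.
  have ns : nbhs z (act s @^-1` [set y | act g y = y]).
    by apply: act_continuous; rewrite sz.
  apply: filterS (filterI nb ns) => y [/= by_ gy].
  by rewrite -{1}by_ !act_mul actKV gy.
have kz : act k z = act s z by exact: nbhs_singleton nz.
have szz : act s z <> z by rewrite sz; exact/nesym.
have kzz : act k z <> z by rewrite kz.
have [|h' [Yh']] := mover effG bX minG pX z
  [:: z; act k z; act k (act k z); act s (act s z)] oY; first by exists z.
rewrite !inE !negb_or => /and4P[h0 h1 h2 h3].
have hk : act h' z \notin [:: z; act k z; act k (act k z)].
  by rewrite !inE !negb_or h0 h1.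
have hs : act h' z \notin [:: z; act s z; act s (act s z)].
  by rewrite !inE !negb_or h0 -kz h1 kz.
have [N1 nN1 NP1] := replace_third_vertex tk kY kzz oY Yh' hk.
have [N2 nN2 NP2] := replace_third_vertex ts sY szz oY Yh' hs.
have Ykz : Y (act k z) by exact: supported_stable.
have [V [t [oV Vz VN rt tY]]] := tricycle_in effG bX oY Yz Ykz Yh' kzz
  (elimN eqP h0) (nesym (elimN eqP h1)) (filterI nz (filterI nN1 nN2)).
have rs : rotates t V s h'.
  have [tt t1 ft] := rt; split=> // y.
    by move=> Vy; have [/= e _] := VN _ Vy; rewrite -e; exact: t1.
  move=> /ft[x Vx e]; exists x => //; have [/= ee _] := VN _ Vx.
  by rewrite -ee.
have Btk : sg_set (alt_on G (Y `\ z)) (t^-1 * k).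
  by apply: (NP1 V) => // y /VN[_ []].
have Bts : sg_set (alt_on G (Y `\ z)) (t^-1 * s).
  by apply: (NP2 V) => // y /VN[_ []].
have Bg : sg_set (alt_on G (Y `\ z)) (g ^ s).
  have -> : g ^ s = (t^-1 * s)^-1 * (t^-1 * k) * (k^-1 * (g * s)).
    by rewrite conjgE invgM invgK !mulgA !mulgK.
  by apply: sgM => //; apply: sgM => //; exact: sgV.
rewrite -(conjgK s g); apply: alt_onS (alt_onJ (h := s^-1) Bg) => y [/= Ysy syz].
split; first by rewrite -(actKV s y); exact: supported_stable Ysy.
by move=> yp; apply: syz; rewrite yp -sz actK.
Qed.

Proposition alternating_fixator (L : seq X) g : sg_set A g ->
  (forall x, x \in L -> nbhs x [set y | act g y = y]) ->
  sg_set (alt_on G (off L)) g.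
Proof.
move=> Ag; elim: L => [_|x L IH gL].
  by rewrite alternating_alt_on // in Ag; apply: alt_onS Ag => y.
have Lg : sg_set (alt_on G (off L)) g.
  by apply: IH => y yL; apply: gL; rewrite in_cons yL orbT.
have nx : nbhs x [set y | act g y = y] by apply: gL; rewrite mem_head.
apply: alt_onS (alt_on_point (off_open G L) Lg nx) => y [yL yx].
by rewrite /off /= in_cons negb_or yL andbT; exact/eqP.
Qed.

End Fixators.

(** * Confined subgroups in the Chabauty space, and the equivalence *)

Section Chabauty.
Variable K : groupType.
Implicit Types (A H : subgroup K) (P : seq K).
Local Open Scope group_scope.

Lemma nbhs_avoiding P : {in P, forall r, r <> 1} ->
  nbhs (sub1 K) [set H | {in P, forall r, ~ sg_set H r}].
Proof.
elim: P => [_|r P IH P1].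
  by apply: filterS (filterT : nbhs (sub1 K) setT) => H _ r.
have {}IH : nbhs (sub1 K) [set H | {in P, forall r, ~ sg_set H r}].
  by apply: IH => s sP; apply: P1; rewrite in_cons sP orbT.
have r1 : r <> 1 by apply: P1; rewrite mem_head.
have nr : nbhs (sub1 K) [set H : subgroup K | ~ sg_set H r].
  apply: open_nbhs_nbhs; split=> //.
  have -> : [set H : subgroup K | ~ sg_set H r] =
      @indicator K @^-1` (proj r @^-1` [set false]).
    apply/seteqP; split=> H; rewrite /indicator /proj /=; first exact: memNset.
    by move=> e /mem_set; rewrite e.
  exists (proj r @^-1` [set false]) => //.
  have cp : continuous (proj r : prod_topology (fun _ : K => bool) -> bool).
    exact: proj_continuous.
  by move/continuousP: cp; apply; exact: discrete_open.
apply: filterS (filterI nr IH) => H [/= nHr HP] s.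
by rewrite in_cons => /orP[/eqP->//|]; exact: HP.
Qed.

(** A neighbourhood of the trivial subgroup constrains finitely many coordinates:
    indicators vanishing on larger and larger finite sets, with value true at 1,
    converge to its indicator. *)
Lemma nbhs_trivial (B : set (subgroup K)) : nbhs (sub1 K) B ->
  exists P, {in P, forall r, r <> 1} /\
    forall H, {in P, forall r, ~ sg_set H r} -> B H.
Proof.
rewrite nbhsE => -[_ [[C oC <-] C1] CB].
pose Fin : set_system (prod_topology (fun _ : K => bool)) :=
  filter_from [set P : seq K | {in P, forall r, r <> 1}]
    (fun P : seq K => [set f | f 1 = true /\ {in P, forall r, f r = false}]).
have FF : Filter Fin.
  apply: filter_from_filter; first by exists [::].
  move=> P Q P1 Q1; exists (P ++ Q).
    by move=> r; rewrite mem_cat => /orP[/P1|/Q1].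
  move=> f [f1 fPQ]; split; split=> // r rP; apply: fPQ;
    by rewrite mem_cat rP ?orbT.
have cF : Fin --> (indicator (sub1 K) : prod_topology (fun _ : K => bool)).
  apply/cvg_sup => r U [V] [[W] oW <-] W1 WU; apply: filterS WU _.
  move: W1; rewrite /= /indicator; case: (pselect (r = 1)) => [->|r1].
    rewrite mem_set// => WT; exists [::] => // f [f1 _] /=.
    by rewrite f1.
  rewrite memNset// => Wf; exists [:: r]; first by move=> s; rewrite inE => /eqP->.
  by move=> f [_ fr] /=; rewrite fr ?mem_head.
have [P P1 PC] := cF C (open_nbhs_nbhs (conj oC C1)).
exists P; split=> // H HP; apply: CB; apply: PC; split.
  by rewrite /indicator mem_set//; exact: sg1.
by move=> r /HP nHr; rewrite /indicator memNset.
Qed.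

Lemma confined_byP A H : confined_by A H <-> exists P,
  {in P, forall r, r <> 1} /\
  forall a, sg_set A a -> exists2 r, r \in P & sg_set H (r ^ a).
Proof.
split=> [nc|[P [P1 PH]] cl]; last first.
  have [L [[a Aa <-] LP]] := cl _ (nbhs_avoiding P1).
  have [r rP Hr] := PH a Aa.
  by apply: (LP r rP); exact/conj_subgroupE.
apply: contrapT => nP; apply: nc => B /nbhs_trivial[P [P1 PB]].
apply: contrapT => ne; apply: nP; exists P; split=> // a Aa.
apply: contrapT => nr; apply: ne; exists (conj_subgroup a H); split.
  by exists a.
by apply: PB => r rP /conj_subgroupE Hr; apply: nr; exists r.
Qed.

End Chabauty.

Section Equivalence.
Variables (X : topologicalType) (G : etale_groupoid X).
Local Notation F := (full_group G).
Local Notation A := (alternating_full_group G).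
Hypothesis effG : effective G.
Hypothesis bX : compact_open_basis X.
Hypothesis minG : minimal G.
Hypothesis pX : no_isolated_point X.
Let T2 : hausdorff_space X := base_hausdorff G.
Implicit Types (g h k t s u v b c j r : full_group G) (x y z p : X).
Implicit Types (U V W Y M O Q : set X) (E : seq X) (H : subgroup F).
Local Open Scope group_scope.

Definition sandwiched H Q : Prop :=
  [/\ finite_set Q, nbhs_fixator A Q `<=` H & H `<=` setwise_stab (subT F) Q].

Lemma tricycle_nbhs_fixator v V Q : tricycle v V -> supported v (~` Q) ->
  nbhs_fixator A Q v.
Proof.
move=> tv vQ; split; first exact: tricycle_alternating tv.
move=> x Qx; apply: (tricycle_fix_near tv); apply: (supported_fix vQ).
exact.
Qed.

Lemma finite_set_listed Q : finite_set Q -> exists L : seq X, forall x, Q x <-> x \in L.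
Proof. by move=> /finite_seqP[L ->]; exists L => x; split. Qed.

(** A point of Q' outside Q could be moved out of Q' by a three-cycle away from Q. *)
Lemma sandwiched_sub H Q Q' : sandwiched H Q -> sandwiched H Q' -> Q' `<=` Q.
Proof.
move=> [/finite_set_listed[L LQ] QH _] [/finite_set_listed[L' LQ'] _ HQ'] x Q'x.
apply: contrapT => nQx.
have xL : off L x by apply/negP => /LQ.
have [|g [Lg L'g]] := mover effG bX minG pX x L' (off_open G L).
  by exists x.
have [t [V [tt tL tx]]] := transporter effG bX minG pX (off_open G L) xL Lg.
have [_ tQ'] : setwise_stab (subT F) Q' t.
  apply/HQ'/QH/(tricycle_nbhs_fixator tt); apply: supportedS tL => y.
  by rewrite /off /= => /negP yL /LQ.
have : Q' (act t x) by rewrite -tQ'; exists x.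
by rewrite tx => /LQ'; apply/negP.
Qed.

Lemma tricycle_in_open U : open U -> U !=set0 ->
  exists t V, [/\ tricycle t V, supported t U & t <> 1].
Proof.
move=> oU [x Ux]; have [|g [Ug]] := mover effG bX minG pX x [:: x] oU.
  by exists x.
rewrite inE => /eqP gx; have [t [V [tt tU tx]]] := transporter effG bX minG pX oU Ux Ug.
by exists t, V; split=> // t1; apply: gx; rewrite -tx t1 act1.
Qed.

(** Take a three-cycle t and, inductively, others in the open set U' of points that
    t fixes: if t moves one of n + 1 points, at most n of them are in U'. *)
Lemma disjoint_tricycles n U : open U -> U !=set0 -> exists P : seq F,
  {in P, forall r, r <> 1 /\ exists2 V, tricycle r V & supported r U} /\
  forall L : seq X, (size L <= n)%N ->
    exists2 r, r \in P & {in L, forall x, act r x = x}.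
Proof.
elim: n U => [|n IH] U oU U0.
  have [t [V [tt tU t1]]] := tricycle_in_open oU U0.
  exists [:: t]; split=> [r|L].
    by rewrite inE => /eqP ->; split=> //; exists V.
  by rewrite leqn0 => /nilP ->; exists t => //; rewrite mem_head.
have [x Ux] := U0.
have oUx : open (U `&` [set y | y <> x]) by apply: openI => //; exact: open_neq.
have [t [V [tt tUx t1]]] : exists t V,
    [/\ tricycle t V, supported t (U `&` [set y | y <> x]) & t <> 1].
  apply: tricycle_in_open => //.
  have [y [Uy]] := avoid_finite T2 [:: x] pX oU U0.
  by rewrite /= inE => /eqP yx; exists y.
have tx : act t x = x by apply: (supported_fix tUx) => -[_]; apply.
pose U' := U `&` [set y | act t y = y].
have oU' : open U'.
  apply: openI => //; rewrite openE => y /= ty.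
  exact: (tricycle_fix_near tt ty).
have [|P [PU PL]] := IH U' oU'; first by exists x.
exists (t :: P); split=> [r|L sL].
  rewrite in_cons => /orP[/eqP->|/PU[r1 [W tr rU']]].
    by split=> //; exists V => //; apply: supportedS tUx => y [].
  by split=> //; exists W => //; apply: supportedS rU' => y [].
case: (pselect ({in L, forall y, act t y = y})) => [tL|ntL].
  by exists t => //; rewrite mem_head.
pose L' := [seq y <- L | act t y == y].
have [|r rP rL'] := PL L'.
  rewrite -ltnS; apply: leq_trans sL.
  rewrite size_filter -(count_predC (fun y => act t y == y) L).
  rewrite -addn1 leq_add2l -has_count; apply: contrapT => /negP nh; apply: ntL => y yL.
  apply/eqP; move/hasPn: nh => /(_ y yL); by rewrite /= negbK.
exists r => [|y yL]; first by rewrite in_cons rP orbT.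
have [ty|ty] := eqVneq (act t y) y; first by apply: rL'; rewrite mem_filter ty eqxx.
have [_ [W _ rU']] := PU r rP.
by apply: (supported_fix rU') => -[_ /=]; exact/eqP.
Qed.

Lemma sandwiched_confined H Q : (exists x : X, True) -> sandwiched H Q -> confined H.
Proof.
move=> [x0 _] [/finite_set_listed[L LQ] QH _]; apply/confined_byP.
have [|P [PU PL]] := disjoint_tricycles (size L) (openT : open [set: X]).
  by exists x0.
exists P; split=> [r /PU[]//|a _].
have [|r rP ra] := PL [seq act a x | x <- L]; first by rewrite size_map.
have [_ [V tr _]] := PU r rP.
exists r => //; apply/QH/(tricycle_nbhs_fixator (tricycleJ a tr)).
by move=> x /moved_conj ne /LQ xL; apply: ne; apply: ra; exact: map_f.
Qed.

Lemma confined_sandwiched H : confined_by A H -> exists Q, sandwiched H Q.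
Proof.
move=> /confined_byP[P [P1 PH]].
have [HO invO [L LO]] := free_part_spec effG bX minG pX P1 PH.
pose L' := [seq x <- L | `[< ~ free_part H x >]].
have L'E x : x \in L' <-> ~ free_part H x.
  rewrite mem_filter; split=> [/andP[/asboolP]//|nO].
  by apply/andP; split; [exact/asboolP|exact: LO].
exists (~` free_part H); split.
- apply: (sub_finite_set (B := [set` L'])); last exact: finite_seq.
  by move=> x /L'E.
- move=> g [Ag gQ]; have Lg : sg_set (alt_on G (off L')) g.
    apply: (alternating_fixator effG bX minG pX Ag) => x /L'E nO.
    exact: gQ.
  move: g {Ag gQ} Lg; apply: gen_sub => v [V tv vL'].
  apply: HO tv _; apply: supportedS vL' => x /negP xL'.
  by apply: contrapT => /L'E.
- move=> h Hh; split=> //; apply/seteqP; split=> [_ [x nO <-]|x nO].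
    by move=> /(invO _ _ Hh).
  exists (act h^-1 x); last by rewrite actKV.
  by move=> /(invO _ _ (sgV Hh)).
Qed.

(** Treat the members of R in turn, each with its own point q; the finite set E
    collects the points frozen by earlier choices. *)
Lemma displace n (R : seq F) (L qs E : seq X) : size R = n ->
  {in R, forall r, r <> 1} -> (size R <= size qs)%N -> uniq qs ->
  {subset qs <= L} -> {in qs, forall q, q \notin E} ->
  exists a, rigid (off E) a /\
    {in R, forall r, exists2 q, q \in qs & act (r ^ a) q \notin L}.
Proof.
elim: n R qs E => [|n IH] R qs E.
  by move=> /size0nil -> *; exists 1; split=> //; exact: rigid1.
case: R => [//|r R] /= [sR] R1; case: qs => [//|q qs] /= sqs /andP[qqs uqs] qsL qE.
have r1 : r <> 1 by apply: R1; rewrite mem_head.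
have qE' : q \notin qs ++ E by rewrite mem_cat negb_or qqs qE ?mem_head.
have [|b [o [bE oL oqE rq]]] := escape effG bX minG pX (off_open G L) _ r1 qE'.
  have [|y [_ yL]] := avoid_finite T2 L pX (openT : open [set: X]).
    by exists q.
  by exists y.
have R1' : {in [seq r ^ b | r <- R], forall r, r <> 1}.
  move=> _ /mapP[s sR' ->] e; apply: (R1 s); first by rewrite in_cons sR' orbT.
  by rewrite -(conjgK b s) e conj1g.
have sR' : size [seq r ^ b | r <- R] = n by rewrite size_map.
have [|||a [aE aR]] := IH [seq r ^ b | r <- R] qs [:: q, o & E] sR' R1' _ uqs.
- by rewrite size_map.
- by move=> x xqs; apply: qsL; rewrite in_cons xqs orbT.
- move=> x xqs; rewrite !in_cons !negb_or qE ?in_cons ?xqs ?orbT// andbT.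
  apply/andP; split; first by apply: contra qqs => /eqP <-.
  by apply: contraNN oL => /eqP <-; apply: qsL; rewrite in_cons xqs orbT.
exists (b * a); split.
  apply: rigidM; first by apply: rigidS bE; exact: off_catr.
  by apply: rigidS aE; exact: (@off_catr _ [:: q; o]).
move=> s; rewrite in_cons => /orP[/eqP->|sR''].
  exists q; first by rewrite mem_head.
  rewrite conjgM (conj_fixed _ rq)//.
  by apply: supportedS aE.2; exact: (@off_catl _ [:: q; o]).
have [x xqs sx] := aR (s ^ b) (map_f _ sR'').
by exists x; [rewrite in_cons xqs orbT|rewrite conjgM].
Qed.

Lemma sandwiched_card H Q (P : set F) : sandwiched H Q -> confining_set P H ->
  (#|` fset_set Q| <= #|` fset_set P| - 1)%N.
Proof.
move=> [fQ _ HQ] [fP P1 PH].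
have PE r : r \in fset_set P <-> P r.
  by rewrite in_fset_set//; split=> [/set_mem|/mem_set].
have QE x : x \in fset_set Q <-> Q x.
  by rewrite in_fset_set//; split=> [/set_mem|/mem_set].
suff : (#|` fset_set Q| < #|` fset_set P|)%N.
  by case: #|` fset_set P| => // n; rewrite subn1.
rewrite ltnNge; apply/negP => le.
have [||||a [_ aR]] := @displace _ (enum_fset (fset_set P)) (enum_fset (fset_set Q))
    (enum_fset (fset_set Q)) [::] erefl _ le.
- by move=> r /PE/P1.
- exact: fset_uniq.
- by [].
- by [].
have [r [Pr /conj_subgroupE Hr]] := PH a.
have [q /QE Qq] := aR r (proj2 (PE r) Pr).
move=> /negP; apply; apply/QE.
by have [_ <-] := HQ _ Hr; exists q.
Qed.

End Equivalence.

Theorem theorem6p1 (X : topologicalType) (G : etale_groupoid X)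
    (cantorX : is_cantor X \/ is_lc_cantor X)
    (minG : minimal G) (effG : effective G) (H : subgroup (full_group G)) :
  let A := alternating_full_group G in
  let F := subT (full_group G) in
  let sandwich (Q : set X) :=
    [/\ finite_set Q, nbhs_fixator A Q `<=` H & H `<=` setwise_stab F Q] in
  let condi := confined H in
  let condii := confined_by A H in
  let condiii := exists! Q : set X, sandwich Q in
  [/\ condi <-> condii, condii <-> condiii &
      condi \/ condii \/ condiii ->
      forall P : set (full_group G), confining_set P H ->
      forall Q : set X, sandwich Q ->
        (#|` fset_set Q| <= #|` fset_set P| - 1)%N].
Proof.
move=> A F sandwich condi condii condiii.
have [bX pX X0] := cantor_cases cantorX.
have i_ii : condi -> condii.
  move=> /confined_byP[P [P1 PH]]; apply/confined_byP; exists P; split=> // a _.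
  exact: PH.
have ii_iii : condii -> condiii.
  move=> /(confined_sandwiched effG bX minG pX)[Q sQ].
  exists Q; split=> // Q' sQ'; have incl := sandwiched_sub effG bX minG pX.
  by apply/seteqP; split; [exact: incl sQ' sQ|exact: incl sQ sQ'].
have iii_i : condiii -> condi.
  by move=> [Q [sQ _]]; exact: sandwiched_confined sQ.
split.
- by split=> // /ii_iii.
- by split=> // /iii_i.
- by move=> _ P cP Q sQ; exact: (sandwiched_card effG bX minG pX sQ cP).
Qed.
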